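(* Let $k\ge1$ and let $X(n)$, $n\ge1$, be independent identically distributed random variables (vectors) with a compact support $M$. For any continuous function $V$ on $M^k$ the limit $$Q(V)=\lim_{N\to\infty}\frac1N\ln E\exp\Big(\sum_{n=1}^N V\big(X(n),X(2n),\dots,X(kn)\big)\Big)=\lim_{N\to\infty}\frac1N\sum_{a\in A_N}\ln E\exp S_{N,a}(V)$$ exists, and the functional $Q(V)$ is convex and lower semicontinuous. If $V=V_\lambda$ depends on a parameter $\lambda$ and has a bounded derivative in $\lambda$, then $Q(V_\lambda)$ is also differentiable in $\lambda$. Thus, for a continuous function $F$ on $M^k$, with $S_N(F)=\sum_{n=1}^N F\big(X(n),X(2n),\dots,X(kn)\big)$ and $$J(u)=\sup_{\lambda\in\mathbb R}\big(\lambda u-Q(\lambda F)\big),\quad u\in\mathbb R,$$ one has for any closed set $K\subset\mathbb R$ $$\limsup_{N\to\infty}\frac1N\ln P\Big\{\frac1N S_N(F)\in K\Big\}\le-\inf_{u\in K}J(u),$$ and for any open set $U\subset\mathbb R$ $$\liminf_{N\to\infty}\frac1N\ln P\Big\{\frac1N S_N(F)\in U\Big\}\ge-\inf_{u\in U}J(u).$$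
   Context: Let $r_1,\dots,r_m\ge2$ be all primes not exceeding $k$. For $N\ge1$ put $$A_N=\{a\le N:\ a\text{ a positive integer relatively prime to } r_1,\dots,r_m\},$$ and for $a\in A_N$ $$B_N(a)=\{b\le N:\ b=a\,r_1^{d_1}r_2^{d_2}\cdots r_m^{d_m}\text{ for some nonnegative integers }d_1,\dots,d_m\}.$$ For a bounded measurable function $V$ on $M^k$, $$S_{N,a}(V)=\sum_{b\in B_N(a)}V\big(X(b),X(2b),\dots,X(kb)\big).$$ *)

(* Defs.v *)
From mathcomp Require Import all_boot all_order all_algebra.
From mathcomp Require Import all_classical all_reals all_analysis.

Set Implicit Arguments.
Unset Strict Implicit.
Unset Printing Implicit Defensive.

Import Order.TTheory GRing.Theory Num.Theory.
Import numFieldNormedType.Exports.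

Local Open Scope classical_set_scope.
Local Open Scope ring_scope.

Definition borel (U : topologicalType) : set (set U) := <<s @open U >>.

Definition borel_measurable (disp : measure_display) (T : measurableType disp)
    (U : topologicalType) (Y : T -> U) : Prop :=
  forall A : set U, borel A -> measurable (Y @^-1` A).

Section iid.
Context (R : realType) (disp : measure_display) (T : measurableType disp).
Context (P : probability T R) (U : topologicalType).

Definition law_support (Y : T -> U) : set U :=
  [set x | forall O : set U, open O -> O x -> (0 < P (Y @^-1` O))%E].

(* The sequences of random variables are indexed by the positive integers:
   nothing is required of X 0. *)
Definition mutually_independent (X : nat -> T -> U) : Prop :=
  forall (s : seq nat) (A : nat -> set U),
    uniq s -> {in s, forall i, (0 < i)%N} -> {in s, forall i, borel (A i)} ->
    P (\bigcap_(i in [set` s]) (X i @^-1` A i)) =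
      (\prod_(i <- s) P (X i @^-1` A i))%E.

Definition identically_distributed (X : nat -> T -> U) : Prop :=
  forall (i j : nat) (A : set U), (0 < i)%N -> (0 < j)%N -> borel A ->
    P (X i @^-1` A) = P (X j @^-1` A).

End iid.

(* (R^d)^k is rendered as the type of k x d matrices, whose rows are the k
   vectors. *)
Definition power_set (R : realType) (k d : nat) (M : set 'rV[R]_d) :
    set 'M[R]_(k, d) :=
  [set x | forall i : 'I_k, M (row i x)].

(* A function on M^k is represented by a function on (R^d)^k of which only the
   values on M^k are used. *)
Definition continuous_on_power (R : realType) (k d : nat) (M : set 'rV[R]_d) :
    set ('M[R]_(k, d) -> R) :=
  [set V | {within power_set M, continuous V}].

Definition primes_upto (k : nat) : seq nat := [seq r <- iota 1 k | prime r].

Definition A_ (k N : nat) : set nat :=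
  [set a | [/\ (0 < a)%N, (a <= N)%N & all (coprime a) (primes_upto k)]].

(* The exponent of the prime r is d r. *)
Definition B_ (k N a : nat) : set nat :=
  [set b | (b <= N)%N /\
    exists d : nat -> nat, b = (a * \prod_(r <- primes_upto k) r ^ d r)%N].

Section nonconventional.
Context (R : realType) (disp : measure_display) (T : measurableType disp).
Context (P : probability T R) (k d : nat).
Context (M : set 'rV[R]_d) (X : nat -> T -> 'rV[R]_d).

Definition tup (n : nat) (w : T) : 'M[R]_(k, d) :=
  \matrix_(i < k) X (i.+1 * n)%N w.

(* V is extended by 0 outside M^k, where (X(n), ..., X(kn)) almost surely does
   not go when M is the support of the law of every X(n). *)
Definition on_power (V : 'M[R]_(k, d) -> R) : 'M[R]_(k, d) -> R :=
  fun x => if x \in power_set M then V x else 0.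

Definition S_ (V : 'M[R]_(k, d) -> R) (N : nat) (w : T) : R :=
  \sum_(1 <= n < N.+1) on_power V (tup n w).

Definition SA_ (V : 'M[R]_(k, d) -> R) (N a : nat) (w : T) : R :=
  \sum_(1 <= b < N.+1 | b \in B_ k N a) on_power V (tup b w).

(* The expectation is a positive real number whenever Y is a bounded random
   variable, which is the only case in which ln_E_exp is used. *)
Definition ln_E_exp (Y : T -> R) : R := ln (fine 'E_P[fun w => expR (Y w)]).

Definition log_moment (V : 'M[R]_(k, d) -> R) : R^nat :=
  fun N => N%:R^-1 * ln_E_exp (S_ V N).

Definition log_moment_split (V : 'M[R]_(k, d) -> R) : R^nat :=
  fun N => N%:R^-1 *
    \sum_(1 <= a < N.+1 | a \in A_ k N) ln_E_exp (SA_ V N a).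

Definition Q (V : 'M[R]_(k, d) -> R) : R := limn (log_moment V).

Definition J (F : 'M[R]_(k, d) -> R) (u : R) : \bar R :=
  ereal_sup (range (fun l : R => (l * u - Q (l \*: F))%:E)).

(* lne 0 = -oo *)
Definition log_prob (F : 'M[R]_(k, d) -> R) (K : set R) : (\bar R)^nat :=
  fun N => ((N%:R^-1)%:E * lne (P [set w | K (N%:R^-1 * S_ F N w)%R]))%E.

End nonconventional.

(* Main.v *)
(* Write every n as a s with a coprime to all primes <= k (rough) and s a product
   of such primes (smooth). Since i n has the same rough part as n for i <= k,
   the blocks S_{N,a} depend on disjoint sets of the X(j), hence are independent,
   and by identity of the laws ln E exp S_{N,a} = g(N / a), where g(m) is the
   log-moment of the sum over the smooth s <= m. Summation by parts turns
   (1/N) sum_a g(N/a) into sum_j (g(j) - g(j-1)) A(N/j)/N, with A counting rough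
   numbers; A(N/j)/N tends to rho/j and is at most 1/j, so that
   Q(V) = rho sum_j (g(j) - g(j-1))/j. The terms vanish unless j is smooth, and
   are Lipschitz in V with constant twice the number of smooth integers <= j over
   j, which is summable over the smooth j because sum_{s smooth} s^{-1/2} is
   finite. Dominated convergence for series then gives both the limit and the
   derivative in a parameter. The large deviation bounds are the one-dimensional
   Gaertner-Ellis theorem.

   Independence is only used for finitely valued functions: by compactness
   V(x_1, ..., x_k) is uniformly close to a function of Borel labels of the x_i,
   which reduces every identity between expectations to a finite product
   space. *)
Require Import Defs.
From mathcomp Require Import all_boot all_order all_algebra.
From mathcomp Require Import all_classical all_reals all_analysis.
From mathcomp Require Import measurable_realfun lra ring.

Set Implicit Arguments.
Unset Strict Implicit.
Unset Printing Implicit Defensive.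

Import Order.TTheory GRing.Theory Num.Theory.
Import numFieldNormedType.Exports.

Local Open Scope classical_set_scope.
Local Open Scope ring_scope.

(** * Bounded random variables *)

Section bounded_expectation.
Context (R : realType) (disp : measure_display) (T : measurableType disp).
Variable P : probability T R.
Implicit Types Y Z : T -> R.

Definition bounded_rv Y :=
  measurable_fun setT Y /\ exists c : R, forall w, `|Y w| <= c.

Local Notation Ex Y := (\int[P]_w Y w).

Lemma bounded_rv_integrable Y : bounded_rv Y -> P.-integrable setT (EFin \o Y).
Proof.
move=> [mY [c Yc]]; apply: measurable_bounded_integrable => //.
- by rewrite /= [ltLHS]probability_setT ltry.
- by exists c; split; [exact: num_real|move=> M cM w _; exact: le_trans (Yc w) (ltW cM)].
Qed.

Lemma bounded_rv_cst (c : R) : bounded_rv (fun=> c).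
Proof. by split; [exact: measurable_cst|exists `|c|]. Qed.

Lemma bounded_rvD Y Z : bounded_rv Y -> bounded_rv Z ->
  bounded_rv (fun w => Y w + Z w).
Proof.
move=> [mY [c Yc]] [mZ [e Ze]]; split; first exact: measurable_funD.
by exists (c + e) => w; rewrite (le_trans (ler_normD _ _))// lerD.
Qed.

Lemma bounded_rvM Y Z : bounded_rv Y -> bounded_rv Z ->
  bounded_rv (fun w => Y w * Z w).
Proof.
move=> [mY [c Yc]] [mZ [e Ze]]; split; first exact: measurable_funM.
by exists (c * e) => w; rewrite normrM ler_pM.
Qed.

Lemma bounded_rvZ (c : R) Y : bounded_rv Y -> bounded_rv (fun w => c * Y w).
Proof. exact/bounded_rvM/bounded_rv_cst. Qed.

Lemma bounded_rv_sum (I : Type) (s : seq I) (p : pred I) (Y : I -> T -> R) :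
  (forall i, p i -> bounded_rv (Y i)) ->
  bounded_rv (fun w => \sum_(i <- s | p i) Y i w).
Proof.
move=> bY; elim: s => [|i s IH].
  under eq_fun do rewrite big_nil.
  exact: bounded_rv_cst.
under eq_fun do rewrite big_cons.
by case pi: (p i) => //; apply: bounded_rvD => //; exact: bY.
Qed.

Lemma bounded_rv_exp Y : bounded_rv Y -> bounded_rv (fun w => expR (Y w)).
Proof.
move=> [mY [c Yc]]; split; first exact: measurableT_comp.
exists (expR c) => w; rewrite ger0_norm ?expR_ge0// ler_expR.
exact: le_trans (ler_norm _) (Yc w).
Qed.

Lemma bounded_rv_indic (A : set T) : measurable A -> bounded_rv (\1_A : T -> R).
Proof.
move=> mA; split; first exact: measurable_indic.
by exists 1 => w; rewrite indicE; case: (_ \in _); rewrite /= ?normr1 ?normr0.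
Qed.

Lemma Ex_cst (c : R) : Ex (fun=> c) = c.
Proof. by rewrite Rintegral_cst//= probability_setT mulr1. Qed.

Lemma ExD Y Z : bounded_rv Y -> bounded_rv Z ->
  Ex (fun w => Y w + Z w) = Ex Y + Ex Z.
Proof. by move=> *; rewrite RintegralD//; exact: bounded_rv_integrable. Qed.

Lemma ExZ (c : R) Y : bounded_rv Y -> Ex (fun w => c * Y w) = c * Ex Y.
Proof. by move=> *; rewrite RintegralZl//; exact: bounded_rv_integrable. Qed.

Lemma Ex_sum (I : Type) (s : seq I) (p : pred I) (Y : I -> T -> R) :
  (forall i, p i -> bounded_rv (Y i)) ->
  Ex (fun w => \sum_(i <- s | p i) Y i w) = \sum_(i <- s | p i) Ex (Y i).
Proof.
move=> bY; elim: s => [|i s IH].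
  by rewrite big_nil; under eq_Rintegral do rewrite big_nil; rewrite Ex_cst.
rewrite big_cons; under eq_Rintegral do rewrite big_cons.
by case pi: (p i) => //; rewrite ExD ?IH//; [exact: bY|exact: bounded_rv_sum].
Qed.

Lemma Ex_le Y Z : bounded_rv Y -> bounded_rv Z -> (forall w, Y w <= Z w) ->
  Ex Y <= Ex Z.
Proof. by move=> bY bZ YZ; apply: le_Rintegral => //; exact: bounded_rv_integrable. Qed.

Lemma Ex_indic (A : set T) : measurable A -> Ex (\1_A : T -> R) = fine (P A).
Proof. by move=> mA; rewrite /Rintegral integral_indic// setIT. Qed.

Lemma Ex_exp_gt0 Y : bounded_rv Y -> 0 < Ex (fun w => expR (Y w)).
Proof.
move=> bY; have [_ [c Yc]] := bY.
apply: (@lt_le_trans _ _ (Ex (fun=> expR (- c)))).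
  by rewrite Ex_cst expR_gt0.
apply: Ex_le => [||w]; [exact: bounded_rv_cst|exact: bounded_rv_exp|].
by rewrite ler_expR; have := Yc w; rewrite ler_norml => /andP[].
Qed.

Lemma ln_E_expE Y : ln_E_exp P Y = ln (Ex (fun w => expR (Y w))).
Proof. by rewrite /ln_E_exp unlock. Qed.

Lemma expR_ln_E_exp Y : bounded_rv Y ->
  expR (ln_E_exp P Y) = Ex (fun w => expR (Y w)).
Proof. by move=> bY; rewrite ln_E_expE lnK// posrE Ex_exp_gt0. Qed.

Lemma ln_E_exp_le Y Z (e : R) : bounded_rv Y -> bounded_rv Z ->
  (forall w, Y w <= Z w + e) -> ln_E_exp P Y <= ln_E_exp P Z + e.
Proof.
move=> bY bZ YZ; rewrite -ler_expR expRD !expR_ln_E_exp// mulrC.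
rewrite -ExZ; last exact: bounded_rv_exp.
apply: Ex_le => [||w]; [exact: bounded_rv_exp|exact/bounded_rvZ/bounded_rv_exp|].
by rewrite -expRD ler_expR addrC.
Qed.

Lemma ln_E_exp_dist Y Z (e : R) : bounded_rv Y -> bounded_rv Z ->
  (forall w, `|Y w - Z w| <= e) -> `|ln_E_exp P Y - ln_E_exp P Z| <= e.
Proof.
move=> bY bZ YZ; rewrite ler_distl lerBlDr !ln_E_exp_le// => w;
  by have := YZ w; rewrite ler_distl => /andP[]; lra.
Qed.

Lemma ln_E_exp0 : ln_E_exp P (fun=> 0) = 0.
Proof. by rewrite ln_E_expE Ex_cst expR0 ln1. Qed.

(* Normalizing both variables so that [E exp = 1] reduces the inequality to
   the convexity of [exp]. *)
Lemma ln_E_exp_convex Y Z (t : R) : bounded_rv Y -> bounded_rv Z ->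
  0 <= t -> t <= 1 ->
  ln_E_exp P (fun w => t * Y w + (1 - t) * Z w) <=
    t * ln_E_exp P Y + (1 - t) * ln_E_exp P Z.
Proof.
move=> bY bZ t0 t1; have := expR_ln_E_exp bZ; have := expR_ln_E_exp bY.
move: (ln_E_exp P Y) (ln_E_exp P Z) => a b EY EZ.
have bYZ : bounded_rv (fun w => t * Y w + (1 - t) * Z w).
  by apply: bounded_rvD; exact: bounded_rvZ.
rewrite -ler_expR expR_ln_E_exp//.
have bE := bounded_rv_exp.
have [c cE] : exists c, c = t * a + (1 - t) * b by eexists.
rewrite -cE.
apply: (@le_trans _ _ (Ex (fun w => expR c * (t * expR (- a)) * expR (Y w) +
    expR c * ((1 - t) * expR (- b)) * expR (Z w)))).
  apply: Ex_le => [||w].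
  - exact: bE.
  - by apply: bounded_rvD; apply: bounded_rvZ; exact: bE.
  - have -> : t * Y w + (1 - t) * Z w =
        c + (t * (Y w - a) + (1 - t) * (Z w - b)) by rewrite cE; ring.
    have := convex_expR (Itv01 t0 t1) (Y w - a) (Z w - b).
    rewrite !convRE/= /unstable.onem => YZab.
    have -> : expR c * (t * expR (- a)) * expR (Y w) +
        expR c * ((1 - t) * expR (- b)) * expR (Z w) =
        expR c * (t * expR (Y w - a) + (1 - t) * expR (Z w - b)).
      by rewrite (expRD (Y w)) (expRD (Z w)); ring.
    by rewrite (expRD c) ler_pM2l ?expR_gt0.
rewrite ExD; [|by apply: bounded_rvZ; exact: bE..].
rewrite !ExZ; [|exact: bE..].
rewrite -EY -EZ !expRN -!mulrA !mulVf ?gt_eqF ?expR_gt0//.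
by rewrite -mulrDr !mulr1 addrC subrK mulr1.
Qed.

(** Differentiation under the expectation: on the whole interval the derivative of [expR (Y t w)] is
    at most the integrable constant [c * expR C] in absolute value. The expectation is positive, so
    composing with [ln] keeps differentiability. *)
Lemma ln_E_exp_derivable (Y : R -> T -> R) (u v a C c : R) :
  a \in `]u, v[ ->
  (forall t, t \in `]u, v[ -> measurable_fun setT (Y t)) ->
  (forall t w, t \in `]u, v[ -> `|Y t w| <= C) ->
  (forall t w, t \in `]u, v[ -> derivable (Y ^~ w) t 1) ->
  (forall t w, t \in `]u, v[ -> `|derive1 (Y ^~ w) t| <= c) ->
  derivable (fun t => ln_E_exp P (Y t)) a 1.
Proof.
move=> Ia mY YC dY Yc.
have bY t : t \in `]u, v[ -> bounded_rv (Y t).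
  by move=> It; split; [exact: mY|exists C => w; exact: YC].
have dE t w : t \in `]u, v[ -> is_derive t 1 (fun t => expR (Y t w))
    (derive1 (Y ^~ w) t * expR (Y t w)).
  move=> It; have dYt : is_derive t 1 (Y ^~ w) (derive1 (Y ^~ w) t).
    by rewrite derive1E; exact/derivableP/dY.
  have := is_derive1_comp (is_derive_expR (Y t w)) dYt.
  by rewrite mulrC.
have dexp t w : t \in `]u, v[ -> partial1of2 (fun t w => expR (Y t w)) t w =
    derive1 (Y ^~ w) t * expR (Y t w).
  by move=> It; have := dE t w It; rewrite partial1of2E; case=> _ <-.
have C0 w : 0 <= C := le_trans (normr_ge0 _) (YC a w Ia).
have c0 w : 0 <= c := le_trans (normr_ge0 _) (Yc a w Ia).
have dEx : derivable (fun t => Ex (fun w => expR (Y t w))) a 1.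
  apply/cvg_ex; eexists.
  under eq_fun do rewrite scaler1.
  apply: (@cvg_differentiation_under_integral R disp T P
    (fun t w => expR (Y t w)) setT measurableT a u v Ia _ _
    (fun=> c * expR C)).
  - by move=> t It; exact/bounded_rv_integrable/bounded_rv_exp/bY.
  - by move=> t w It _; have [] := dE t w It.
  - by move=> w; rewrite mulr_ge0 ?expR_ge0// (c0 w).
  - exact/bounded_rv_integrable/bounded_rv_cst.
  - move=> t w It _; rewrite dexp// normrM ler_pM// ?Yc//.
    by rewrite ger0_norm ?expR_ge0// ler_expR (le_trans (ler_norm _))// YC.
under eq_fun do rewrite ln_E_expE.
have := is_derive1_comp (is_derive1_ln (Ex_exp_gt0 (bY _ Ia)))
  (derivableP dEx).
by case.
Qed.

End bounded_expectation.

(** * The one-dimensional Gaertner-Ellis theorem *)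

Section ereal_limits.
Context (R : realType).
Implicit Types (u : (\bar R)^nat) (x : \bar R).
Local Open Scope ereal_scope.

Lemma limn_esup_le_near u x : (\forall N \near \oo, u N <= x) -> limn_esup u <= x.
Proof.
move=> ux; rewrite /limn_esup limf_esupE.
apply: (@le_trans _ _ (ereal_sup (u @` [set N | u N <= x]))).
  by apply: ereal_inf_lbound; exists [set N | u N <= x].
by apply: ge_ereal_sup => _ [N /= uNx <-].
Qed.

Lemma limn_einf_ge_near u x : (\forall N \near \oo, x <= u N) -> x <= limn_einf u.
Proof.
move=> ux; rewrite /limn_einf leeNr; apply: limn_esup_le_near.
by apply: filterS ux => N; rewrite leeN2.
Qed.

(** Allows an infimum of [J], possibly infinite, to be tested only at the real levels strictly below
    it. *)
Lemma leeN_lt x y : (forall a : R, a%:E < y -> x <= (- a)%:E) -> x <= - y.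
Proof.
case: y => [r| |] h.
- apply/lee_addgt0Pr => e e0.
  have := h (r - e)%R; rewrite lte_fin ltrBlDr ltrDl => /(_ e0).
  by rewrite opprB addrC EFinD EFinN.
- have {}h a : x <= a%:E by have := h (- a)%R; rewrite opprK; apply; rewrite ltry.
  rewrite leeNy_eq; case: x h => [r| |] h //.
  + by have := h (r - 1)%R; rewrite lee_fin => ?; exfalso; lra.
  + by have := h 0%R; rewrite leye_eq.
- by rewrite leey.
Qed.

End ereal_limits.

Section gaertner_ellis.
Context (R : realType) (disp : measure_display) (T : measurableType disp).
Variables (P : probability T R) (S : nat -> T -> R) (q : R -> R) (c : R).
Hypothesis mS : forall N, measurable_fun setT (S N).
Hypothesis S_le : forall N w, `|S N w| <= N%:R * c.
Hypothesis cvg_q : forall l : R,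
  N%:R^-1 * ln_E_exp P (fun w => l * S N w) @[N --> \oo] --> q l.
Hypothesis dq : forall l : R, derivable q l 1.

Let J (u : R) : \bar R := ereal_sup (range (fun l : R => (l * u - q l)%:E)).
Let log_pr (K : set R) : (\bar R)^nat := fun N =>
  ((N%:R^-1)%:E * lne (P [set w | K (N%:R^-1 * S N w)%R]))%E.
Local Notation Ex Y := (\int[P]_w Y w).
Let qN (N : nat) (l : R) : R := N%:R^-1 * ln_E_exp P (fun w => l * S N w).

Let bZS N (l a : R) : bounded_rv (fun w => l * S N w - a).
Proof.
apply: bounded_rvD; last exact: bounded_rv_cst.
by apply: bounded_rvZ; split => //; exists (N%:R * c).
Qed.

Let Ex_expZS N (l a : R) : (0 < N)%N ->
  Ex (fun w => expR (l * S N w - a)) = expR (N%:R * qN N l - a).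
Proof.
move=> N0; rewrite /qN mulrA divff ?pnatr_eq0 -?lt0n// mul1r.
rewrite expRD expR_ln_E_exp; last first.
  by have := bZS N l 0; under eq_fun do rewrite subr0.
rewrite mulrC -ExZ.
  by apply: eq_Rintegral => w _; rewrite expRD mulrC.
by apply: bounded_rv_exp; have := bZS N l 0; under eq_fun do rewrite subr0.
Qed.

Let mpre (K : set R) N : measurable K ->
  measurable [set w | K (N%:R^-1 * S N w)].
Proof.
move=> mK; rewrite -[X in measurable X]setTI.
by apply: (measurable_funM (measurable_cst _) (mS N)).
Qed.

Let fin_pre (K : set R) N : measurable K ->
  P [set w | K (N%:R^-1 * S N w)] =
  (Ex (\1_[set w | K (N%:R^-1 * S N w)]))%:E.
Proof.
by move=> mK; rewrite Ex_indic ?fineK ?fin_num_measure//; exact: mpre.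
Qed.

Let scaledS N w (u : R) : (0 < N)%N -> u = N%:R^-1 * S N w -> S N w = N%:R * u.
Proof.
by move=> N0 ->; rewrite mulrA divff ?mul1r// pnatr_eq0 -lt0n.
Qed.

(** Exponential Chebyshev inequality with finitely many tilts. The averages stay in [[- c, c]], so
    only a compact part of [K] matters; for a level [a] below the infimum of [J], each of its points
    [v] has a tilt [l] with [a < l * v - q l], and finitely many such open conditions cover it. *)
Lemma ge_upper_bound (K : set R) : closed K ->
  (limn_esup (log_pr K) <= - ereal_inf [set J u | u in K])%E.
Proof.
move=> cK; apply: leeN_lt => a aI.
pose U l := [set v : R | a < l * v - q l].
have oU l : open (U l).
  apply: (@open_comp _ _ (fun v : R => l * v - q l) [set x | a < x]).
    move=> v _; apply: cvgB; last exact: cvg_cst.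
    by apply: cvgM; [exact: cvg_cst|exact: cvg_id].
  exact: open_gt.
have cKc : compact (`[- c, c]%classic `&` K).
  by apply: compact_closedI => //; exact: segment_compact.
move: cKc; rewrite compact_cover => /(_ _ setT U (fun l _ => oU l)) [].
  move=> v [_ Kv]; have : (a%:E < J v)%E.
    by apply: lt_le_trans aI _; apply: ereal_inf_lbound; exists v.
  by move=> /ereal_sup_gt[_ [l _ <-]]; rewrite lte_fin => al; exists l.
move=> D _ KD.
have [s Ks] : exists s : seq R,
    forall v, - c <= v <= c -> K v -> exists2 l, l \in s & U l v.
  by exists (finmap.enum_fset D) => v vc Kv; have [|l lD Ul] := KD v;
    [split => //=; rewrite in_itv|exists l].
apply/lee_addgt0Pr => e e0.
(* The successor keeps [n] positive even when no tilt is selected. The factor [n] of the union bound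
   costs [ln n], which is below [e / 2 * N] for large [N]. *)
pose n : R := (size s).+1%:R.
have n0 : 0 < n by rewrite ltr0n.
have e30 : 0 < e / 2 by lra.
apply: limn_esup_le_near.
have near_D : \forall N \near \oo,
    forall l, l \in s -> qN N l <= q l + e / 2.
  elim: (s) => [|l s' IH]; first by near=> N.
  have /cvgrPdist_lt/(_ _ e30) ql := @cvg_q l.
  near=> N => l'; rewrite inE => /orP[/eqP->|l's'].
    have : `|q l - qN N l| < e / 2 by near: N.
    by rewrite ltr_distl; lra.
  suff : forall l, l \in s' -> qN N l <= q l + e / 2 by exact.
  by near: N.
near=> N.
have N0 : (0 < N)%N by near: N; exact: nbhs_infty_gt.
have N0R : 0 < N%:R :> R by rewrite ltr0n.
rewrite /log_pr fin_pre; last exact: closed_measurable.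
set p := Ex _.
have pn : p <= n * expR (N%:R * (e / 2 - a)).
  apply: (@le_trans _ _ (Ex (fun w => \sum_(l <- s)
      expR (l * S N w - N%:R * (q l + a))))).
    apply: Ex_le => [||w].
    - by apply: bounded_rv_indic; apply: mpre; exact: closed_measurable.
    - by apply: bounded_rv_sum => l _; exact: bounded_rv_exp.
    - rewrite indicE; case: (boolP (w \in _)) => [|_]; last first.
        by rewrite /= sumr_ge0// => l _; exact: expR_ge0.
      rewrite inE /= => Kw.
      have [||l lD] := Ks (N%:R^-1 * S N w) => //.
        rewrite -ler_norml normrM ger0_norm ?invr_ge0//.
        by rewrite mulrC ler_pdivrMr// mulrC.
      rewrite /U/= => al.
      rewrite (big_rem l)//=.
      apply: (@le_trans _ _ (expR (l * S N w - N%:R * (q l + a)))); last first.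
        by rewrite lerDl sumr_ge0// => i _; exact: expR_ge0.
      rewrite -[leLHS]expR0 ler_expR.
      have -> : l * S N w - N%:R * (q l + a) =
          N%:R * (l * (N%:R^-1 * S N w) - q l - a).
        by rewrite {1}(@scaledS N w _ N0 erefl); ring.
      by rewrite mulr_ge0// subr_ge0 ltW.
  rewrite Ex_sum; last by move=> l _; exact: bounded_rv_exp.
  apply: (@le_trans _ _ (\sum_(l <- s)
      expR (N%:R * (e / 2 - a)))).
    rewrite big_seq [leRHS]big_seq; apply: ler_sum => l lD.
    rewrite Ex_expZS// ler_expR -mulrBr ler_pM2l//.
    have : forall l, l \in s -> qN N l <= q l + e / 2 by near: N.
    by move=> /(_ l lD); lra.
  rewrite big_const_seq count_predT iter_addr_0 -[leLHS]mulr_natl.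
  by rewrite ler_pM2r ?expR_gt0// ler_nat.
have p0 : 0 <= p by apply: Rintegral_ge0 => w _; rewrite indicE.
move: p0; rewrite le_eqVlt => /predU1P[<-|p0].
  by rewrite le0_lneNy// gt0_muleNy ?leNye// lte_fin invr_gt0.
rewrite lne_EFin// -EFinM -EFinD lee_fin ler_pdivrMl//.
apply: (@le_trans _ _ (ln (n * expR (N%:R * (e / 2 - a))))).
  by rewrite ler_ln// posrE mulr_gt0 ?expR_gt0.
rewrite lnM ?posrE ?expR_gt0// expRK.
have : ln n < e / 2 * N%:R.
  rewrite -ltr_pdivrMl//; near: N; exact: nbhs_infty_gtr.
lra.
Unshelve. all: by end_near. Qed.

Let is_dq (l : R) : is_derive l 1 q (derive1 q l).
Proof. by rewrite derive1E; exact/derivableP. Qed.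

(* The tilt minimizes [q l - l u + h l^2 / 2]: the quadratic penalty forces the
   minimum to be attained while moving the slope away from [u] by at most
   [sqrt (2 h (j + q 0))]. *)
Lemma exposed_slope (u j r : R) : 0 < r -> (J u <= j%:E)%E ->
  exists l : R, `|derive1 q l - u| < r /\ l * derive1 q l - q l <= j.
Proof.
move=> r0 Juj.
have Jle l : l * u - q l <= j.
  rewrite -lee_fin; apply: le_trans Juj.
  by apply: ereal_sup_ubound; exists l.
(* The tilt 0 shows that [j + q 0] is nonnegative. The penalty [h] is chosen so that
   [2 * h * m = r ^+ 2], and [B] so that the penalty at [B] equals [m]: at both ends of [[- B, B]]
   the penalized function then exceeds its value at 0, and its minimum is interior. *)
pose m := j + q 0 + 1.
have m1 : 1 <= m by have := Jle 0; rewrite /m; lra.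
have m0 : 0 < m by lra.
pose h := r ^+ 2 / (2 * m).
have h0 : 0 < h by rewrite divr_gt0 ?exprn_gt0// mulr_gt0.
pose B := 2 * m / r.
have B0 : 0 < B by rewrite divr_gt0 ?mulr_gt0.
pose f l := q l - u * l + h / 2 * l ^+ 2.
have f_ge l : h / 2 * l ^+ 2 - j <= f l by have := Jle l; rewrite /f; lra.
have hB : h / 2 * B ^+ 2 = m.
  by rewrite /h /B; field; rewrite !gt_eqF.
have df (l : R) : is_derive l 1 (f : R -> R) (derive1 q l - u + h * l).
  have d2 := is_deriveZ (h / 2) (@is_deriveX R R^o id 2 l 1 1 (is_derive_id l 1)).
  have d1 := is_deriveZ u (is_derive_id l (1 : R)).
  have d := is_deriveD (is_deriveB (is_dq l) d1) d2.
  suff <- : derive1 q l - u *: 1 + (h / 2) *: ((2%:R * l ^+ 1) *: 1) =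
      derive1 q l - u + h * l by exact: d.
  by rewrite /GRing.scale/=; field.
have cf : {within `[- B, B], continuous f}.
  by apply: derivable_within_continuous => l _; have [] := df l.
have [|l0 l0B fl0] := EVT_min _ cf; first by lra.
have f0 : f 0 = q 0 by rewrite /f; ring.
have fl0_le : f l0 <= q 0.
  by rewrite -f0; apply: fl0; rewrite in_itv/=; lra.
have l0m : h / 2 * l0 ^+ 2 < m.
  by have := f_ge l0; rewrite /m; lra.
have l0lt : - B < l0 < B.
  rewrite -ltr_norml -(@ltr_pXn2r _ 2%N) ?nnegrE//; last exact: ltW.
  rewrite real_normK ?num_real//.
  have : h / 2 * l0 ^+ 2 < h / 2 * B ^+ 2 by rewrite hB.
  by rewrite ltr_pM2l// divr_gt0.
have := @derive1_at_min _ f (- B) B l0.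
move=> /(_ _ _ _ _)[||||].
- by lra.
- by move=> t _; have [] := df t.
- by rewrite in_itv.
- by move=> t tB; apply: fl0; exact: subset_itv_oo_cc.
move=> _; have [_ ->] := df l0 => dl0.
exists l0; split.
  have -> : derive1 q l0 - u = - (h * l0) by lra.
  rewrite normrN -(@ltr_pXn2r _ 2%N) ?nnegrE//; last exact: ltW.
  rewrite real_normK ?num_real// exprMn.
  have -> : h ^+ 2 * l0 ^+ 2 = (2 * h) * (h / 2 * l0 ^+ 2) by field.
  have -> : r ^+ 2 = (2 * h) * m by rewrite /h; field; rewrite gt_eqF.
  by rewrite ltr_pM2l// mulr_gt0.
have -> : derive1 q l0 = u - h * l0 by lra.
apply: le_trans (Jle l0).
by rewrite lerD2r mulrBr gerBl mulrCA mulr_ge0 ?(ltW h0)// -expr2 sqr_ge0.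
Qed.

(** First-order expansion of [q] on both sides of [l]: the tilt [l + t] will control averages above
    the slope, the tilt [l - t] those below it. *)
Let near_tilt l (e : R) : 0 < e ->
  \forall t \near 0^'+, q (l + t) <= q l + t * (derive1 q l + e) /\
                        q (l - t) <= q l - t * (derive1 q l - e).
Proof.
move=> e0; have [] := is_dq l; rewrite /derivable -/(_^`()%classic) => /cvg_ex[/= v qv].
rewrite derive1E => _; rewrite /derive (cvg_lim _ qv)//.
move/cvgrPdist_lt : qv => /(_ _ e0)[d /= d0 qd].
exists d => //= t /=; rewrite sub0r normrN => td t0.
split.
- have := qd t; rewrite /= sub0r normrN => /(_ td (lt0r_neq0 t0)).
  rewrite /GRing.scale/= mulr1 ltr_distl => /andP[+ _].
  rewrite ltrBlDr mulrC [t + l]addrC ltr_pdivrMr//; lra.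
- have := qd (- t); rewrite /= sub0r !normrN => /(_ td).
  rewrite oppr_eq0 => /(_ (lt0r_neq0 t0)).
  rewrite /GRing.scale/= mulr1 ltr_distl => /andP[_].
  rewrite [- t + l]addrC => qt.
  suff : (q (l - t) - q l) < - t * (v - e) by lra.
  have : (q (l - t) - q l) / t < e - v by rewrite invrN in qt; lra.
  by rewrite ltr_pdivrMr//; lra.
Qed.

(** Weighted by [expR (l * S N w)], the average concentrates at the slope [v] of [q] at [l], and
    [exposed_slope] provides an [l] with [v] close to [u] at no greater cost than [J u]. Instead of
    changing the measure, the indicator of the event is minorized by a combination of three
    exponentials. *)
Lemma ge_lower_bound (U : set R) : open U ->
  (- ereal_inf [set J u | u in U] <= limn_einf (log_pr U))%E.
Proof.
move=> oU; rewrite leeNl; apply: le_ereal_inf_tmp => _ [u Uu <-].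
rewrite leeNl.
case Ju : (J u) => [j| |]; [|by rewrite leNye|]; last first.
  have : ((0 * u - q 0)%:E <= J u)%E by apply: ereal_sup_ubound; exists 0.
  by rewrite Ju leeNy_eq.
apply/lee_subgt0Pr => e e0.
have /nbhs_ballP[r /= r0 rU] : nbhs u U by exact: open_nbhs_nbhs.
have r20 : 0 < r / 2 by lra.
have [||l [lr lj]] := @exposed_slope u j (r / 2); [by []|by rewrite Ju|].
set v := derive1 q l in lr lj.
(* The first bound keeps the window around [v] inside [U]; the second makes the variation of [l * x]
   over the window at most [e / 4]. *)
pose s := Num.min (r / 2) (e / (4 * (`|l| + 1))).
have s0 : 0 < s.
  by rewrite lt_min r20/= divr_gt0// mulr_gt0// ltr_wpDl.
have sr : s <= r / 2 by rewrite ge_min lexx.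
have ls : `|l| * s <= e / 4.
  apply: (@le_trans _ _ (`|l| * (e / (4 * (`|l| + 1))))).
    by rewrite ler_wpM2l// ge_min lexx orbT.
  rewrite mulrA ler_pdivrMr ?mulr_gt0 ?ltr_wpDl//.
  have -> : e / 4 * (4 * (`|l| + 1)) = `|l| * e + e by field.
  by rewrite lerDl ltW.
have s20 : 0 < s / 2 by lra.
have ball_U x : `|x - v| < s -> U x.
  move=> xv; apply: rU; rewrite /ball/= distrC.
  have -> : x - u = (x - v) + (v - u) by ring.
  by rewrite (le_lt_trans (ler_normD _ _))//; lra.
near (0 : R)^'+ => t.
have t0 : 0 < t by near: t; exact: nbhs_right_gt.
have [ltp ltm] : q (l + t) <= q l + t * (v + s / 2) /\
    q (l - t) <= q l - t * (v - s / 2) by near: t; exact: near_tilt.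
have ts0 : 0 < t * s by rewrite mulr_gt0.
have ts80 : 0 < t * s / 8 by lra.
have e40 : 0 < e / 4 by lra.
have /cvgrPdist_lt/(_ _ ts80) cvp := @cvg_q (l + t).
have /cvgrPdist_lt/(_ _ ts80) cvm := @cvg_q (l - t).
have /cvgrPdist_lt cv0 := @cvg_q l.
apply: limn_einf_ge_near; near=> N.
have N0 : (0 < N)%N by near: N; exact: nbhs_infty_gt.
have N0R : 0 < N%:R :> R by rewrite ltr0n.
have qp : `|q (l + t) - qN N (l + t)| < t * s / 8 by near: N.
have qm : `|q (l - t) - qN N (l - t)| < t * s / 8 by near: N.
have q0 : `|q l - qN N l| < t * s / 8 by near: N; exact: cv0.
have qe : `|q l - qN N l| < e / 4 by near: N; exact: cv0.
rewrite ltr_distl in qp; rewrite ltr_distl in qm.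
rewrite ltr_distl in q0; rewrite ltr_distl in qe.
(* Out of a gain [t * s], the expansion of [q] costs [t * s / 2] and the convergence of [qN] costs
   [t * s / 8] at each of two tilts. The remaining [t * s / 4] reduces each correcting exponential
   to a quarter of the main one once [N] is large. *)
have small x : x <= qN N l - t * s / 4 ->
    expR (N%:R * x) <= expR (N%:R * qN N l) / 4.
  move=> xq; rewrite -[X in _ / X]lnK ?posrE// -expRN -expRD ler_expR.
  apply: (@le_trans _ _ (N%:R * (qN N l - t * s / 4))); first by rewrite ler_pM2l.
  rewrite mulrBr lerD2l lerN2.
  rewrite mulrC -ler_pdivrMl//; last by lra.
  by apply: ltW; near: N; exact: nbhs_infty_gtr.
rewrite /log_pr fin_pre; last exact: open_measurable.
set p := Ex _.
pose a := N%:R * (l * v + `|l| * s).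
have pge : expR (- a) * (expR (N%:R * qN N l) / 2) <= p.
  have p1 : N%:R * qN N (l + t) - N%:R * (t * (v + s)) =
    N%:R * (qN N (l + t) - t * (v + s)) by ring.
  have m1 : N%:R * qN N (l - t) - N%:R * (- t * (v - s)) =
    N%:R * (qN N (l - t) + t * (v - s)) by ring.
  (* If the average is at least [v + s] or at most [v - s], one of the subtracted exponentials
     dominates the first and [Z] is nonpositive. Inside the window [Z w] is at most
     [expR (l * S N w)], hence at most [expR a]. So [expR (- a) * Z] lies below the indicator. *)
  pose Z w := expR (l * S N w - 0)
    + (- 1 * expR ((l + t) * S N w - N%:R * (t * (v + s)))
       + - 1 * expR ((l - t) * S N w - N%:R * (- t * (v - s)))).
  have bE l' a' : bounded_rv (fun w => expR (l' * S N w - a')).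
    exact: bounded_rv_exp.
  have bZ : bounded_rv Z.
    apply: bounded_rvD => //.
    by apply: bounded_rvD => //; exact: bounded_rvZ.
  apply: (@le_trans _ _ (Ex (fun w => expR (- a) * Z w))).
    rewrite ExZ// ler_pM2l ?expR_gt0// ExD//; last first.
      by apply: bounded_rvD => //; exact: bounded_rvZ.
    rewrite ExD; [|exact: bounded_rvZ..].
    rewrite !ExZ// !Ex_expZS// subr0 p1 m1.
    have hp : qN N (l + t) - t * (v + s) <= qN N l - t * s / 4.
      by lra.
    have hm : qN N (l - t) + t * (v - s) <= qN N l - t * s / 4.
      by lra.
    move: (small _ hp) (small _ hm); lra.
  apply: Ex_le => [||w].
  - exact: bounded_rvZ.
  - by apply: bounded_rv_indic; apply: mpre; exact: open_measurable.
  set x := N%:R^-1 * S N w.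
  have Sx : S N w = N%:R * x by exact: scaledS.
  have aE : a = N%:R * (l * v + `|l| * s) by [].
  have Z_le : Z w <= expR (l * S N w).
    rewrite /Z subr0; have := expR_ge0 ((l + t) * S N w - N%:R * (t * (v + s))).
    by have := expR_ge0 ((l - t) * S N w - N%:R * (- t * (v - s))); lra.
  have [xv|xv] := ltP `|x - v| s.
    rewrite indicE mem_set/=; last exact: ball_U.
    apply: (@le_trans _ _ (expR (- a) * expR (l * S N w))).
      by rewrite ler_pM2l ?expR_gt0.
    rewrite -expRD -[leRHS]expR0 ler_expR aE Sx addrC subr_le0 mulrCA.
    rewrite ler_pM2l// -lerBlDl -mulrBr.
    by rewrite (le_trans (ler_norm _))// normrM ler_wpM2l// ltW.
  apply: (@le_trans _ _ 0); last by rewrite indicE.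
  rewrite pmulr_rle0 ?expR_gt0// /Z subr0.
  move: xv; rewrite ler_normr => /orP[xv|xv].
    have : expR (l * S N w) <= expR ((l + t) * S N w - N%:R * (t * (v + s))).
      rewrite ler_expR Sx.
      have -> : (l + t) * (N%:R * x) - N%:R * (t * (v + s)) =
        l * (N%:R * x) + N%:R * t * (x - v - s) by ring.
      by rewrite lerDl mulr_ge0 ?subr_ge0// mulr_ge0// ltW.
    by have := expR_ge0 ((l - t) * S N w - N%:R * (- t * (v - s))); lra.
  have : expR (l * S N w) <= expR ((l - t) * S N w - N%:R * (- t * (v - s))).
    rewrite ler_expR Sx.
    have -> : (l - t) * (N%:R * x) - N%:R * (- t * (v - s)) =
      l * (N%:R * x) + N%:R * t * (- (x - v) - s) by ring.
    by rewrite lerDl mulr_ge0 ?subr_ge0// mulr_ge0// ltW.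
  by have := expR_ge0 ((l + t) * S N w - N%:R * (t * (v + s))); lra.
have p0 : 0 < p.
  apply: lt_le_trans pge.
  by rewrite mulr_gt0 ?expR_gt0// divr_gt0 ?expR_gt0.
rewrite lne_EFin// -EFinM -EFinB lee_fin ler_pdivlMl//.
apply: (@le_trans _ _ (ln (expR (- a) * (expR (N%:R * qN N l) / 2)))); last first.
  by rewrite ler_ln// posrE mulr_gt0 ?expR_gt0// divr_gt0 ?expR_gt0.
rewrite lnM ?posrE ?expR_gt0 ?divr_gt0 ?expR_gt0// expRK lnM ?posrE ?expR_gt0//.
rewrite expRK lnV ?posrE//.
have : ln 2 < e / 4 * N%:R :> R.
  rewrite -ltr_pdivrMl//; near: N; exact: nbhs_infty_gtr.
move=> ln2.
apply: (@le_trans _ _ (N%:R * (qN N l - l * v - `|l| * s - e / 4))).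
  by rewrite ler_pM2l//; lra.
by rewrite /a; lra.
Unshelve. all: by end_near.
Qed.

End gaertner_ellis.

(** * Dominated convergence of series; smooth and rough numbers *)

Section dominated_series.
Context (R : realType).
Implicit Types b f : R^nat.

Lemma cvg_series_dominated b f : cvgn (series b) -> (forall j, `|f j| <= b j) ->
  cvgn (series f).
Proof.
move=> cb fb; apply: normed_cvg; apply: series_le_cvg cb => [j|j|j]; last exact: fb.
  exact: normr_ge0.
exact: le_trans (fb j).
Qed.

Lemma series_tail_le b f n : cvgn (series b) -> (forall j, `|f j| <= b j) ->
  `|limn (series f) - series f n| <= limn (series b) - series b n.
Proof.
move=> cb fb; have cf := cvg_series_dominated cb fb.
have : `|series f m - series f n| @[m --> \oo] --> `|limn (series f) - series f n|.
  by apply: cvg_norm; apply: cvgB => //; exact: cvg_cst.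
have : series b m - series b n @[m --> \oo] --> limn (series b) - series b n.
  by apply: cvgB => //; exact: cvg_cst.
move=> cbn cfn; apply: ler_cvg_to cfn cbn _.
near=> m; have nm : (n <= m)%N by near: m; exact: nbhs_infty_ge.
rewrite !sub_series_geq//.
by rewrite (le_trans (ler_norm_sum _ _ _))// ler_sum.
Unshelve. all: by end_near. Qed.

(** The tails are uniformly small by domination, which leaves a finite partial sum. The filter is
    arbitrary because the lemma serves both [N] tending to infinity and difference quotients with
    increment tending to 0. *)
Lemma dominated_cvg_series (I : Type) (F : set_system I) {FF : ProperFilter F}
    (u : I -> R^nat) b l :
  cvgn (series b) -> (\forall i \near F, forall j, `|u i j| <= b j) ->
  (forall j, u i j @[i --> F] --> l j) ->
  limn (series (u i)) @[i --> F] --> limn (series l).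
Proof.
move=> cb ub ul.
have lb j : `|l j| <= b j.
  have unl : `|u i j| @[i --> F] --> `|l j| by apply: cvg_norm; exact: ul.
  apply: (cvgr_to_le unl).
  by apply: filterS ub => i; exact.
apply/cvgrPdist_lt => e e0; have e30 : 0 < e / 3 by lra.
have /cvgrPdist_lt/(_ _ e30)[n _ /(_ n (leqnn n))] := cb; rewrite /=.
rewrite ltr_distl => bn.
have : series (u i) n @[i --> F] --> series l n.
  rewrite /series/=; elim: n {bn} => [|n IH].
    by under eq_fun do rewrite big_geq//; rewrite big_geq//; exact: cvg_cst.
  under eq_fun do rewrite big_nat_recr//=.
  by rewrite big_nat_recr//=; apply: cvgD.
move=> /cvgrPdist_lt/(_ _ e30) un.
near=> i.
have ui : forall j, `|u i j| <= b j by near: i.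
have uin : `|series l n - series (u i) n| < e / 3 by near: i.
have := series_tail_le n cb ui; have := series_tail_le n cb lb.
rewrite !ler_distl; move: uin; rewrite ltr_distl ltr_norml; lra.
Unshelve. all: by end_near. Qed.

End dominated_series.

(** * Sparsity of the smooth integers *)

Section smooth_numbers.
Implicit Types k n N a : nat.

Definition upto k : nat_pred := [pred p | (p <= k)%N].

(** The predicate [upto k] is tested on prime divisors only. The number 0 is not smooth, so terms of
    index 0 drop out of the series below. *)
Definition smooth k : pred nat := fun n => (upto k).-nat n.

Definition rough_part k n : nat := n`_(negn (upto k)).

(** Reindexing by [b = a * s], used for the multiples of [k.+1] among smooth numbers and for the
    block of a rough [a]. *)
Lemma sum_multiples (V : nmodType) (F : nat -> V) (p q : pred nat) a N :
  (0 < a)%N -> (forall b, (0 < b)%N -> p b = (a %| b)%N && q (b %/ a)%N) ->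
  \sum_(1 <= b < N.+1 | p b) F b =
  \sum_(1 <= s < (N %/ a).+1 | q s) F (a * s)%N.
Proof.
move=> a0 pq; rewrite big_nat_cond.
under eq_bigl => b do rewrite andbC.
rewrite -big_filter -[RHS]big_filter -[RHS](big_map (muln a) predT).
apply: perm_big; apply: uniq_perm.
- by rewrite filter_uniq// iota_uniq.
- rewrite map_inj_uniq ?filter_uniq ?iota_uniq// => x y /eqP.
  by rewrite eqn_pmul2l// => /eqP.
- move=> b; rewrite mem_filter mem_index_iota; apply/idP/mapP.
    move=> /andP[/andP[+ /andP[b0 bN]] _]; rewrite pq//.
    move=> /andP[/dvdnP[s bE]]; rewrite {}bE in b0 bN *.
    rewrite mulnK// => qs; move: b0; rewrite muln_gt0 => /andP[s0 _].
    exists s; last by rewrite mulnC.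
    by rewrite mem_filter qs mem_index_iota s0/= ltnS leq_divRL.
  move=> [s]; rewrite mem_filter mem_index_iota => /andP[qs /andP[s0 sN] ->].
  have as0 : (0 < a * s)%N by rewrite muln_gt0 a0.
  rewrite pq// dvdn_mulr//= mulKn// qs/= as0/= andbb ltnS.
  by rewrite mulnC -leq_divRL.
Qed.

Lemma smoothS k n : smooth k.+1 n -> ~~ (k.+1 %| n)%N -> smooth k n.
Proof.
move=> /andP[n0 /allP nk] kn; rewrite /smooth /pnat n0; apply/allP => p pn.
have := nk p pn; rewrite !inE leq_eqVlt ltnS => /orP[/eqP pk|//].
by move: pn kn; rewrite mem_primes pk => /and3P[_ _ ->].
Qed.

Lemma smoothM k m n : smooth k (m * n) = smooth k m && smooth k n.
Proof. exact: pnatM. Qed.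

Lemma smooth1 n : smooth 1 n -> n = 1%N.
Proof.
move=> /andP[n0 /allP nk]; apply/eqP; rewrite eqn_leq n0 andbT leqNgt.
apply/negP => n1; have := nk (pdiv n).
rewrite mem_primes pdiv_prime// n0 pdiv_dvd => /(_ isT); rewrite inE.
by rewrite leqNgt prime_gt1// pdiv_prime.
Qed.

(** Induction on [k]. A [k.+1]-smooth number is either [k]-smooth or [k.+1] times a [k.+1]-smooth
    number, so the new sum is at most [c] plus itself divided by the square root of [k.+1]. As that
    root exceeds 1, the inequality can be solved for the sum. *)
Lemma sum_smooth_invsqrt_bounded (R : realType) k : exists c : R, forall N,
  \sum_(1 <= s < N.+1 | smooth k s) (Num.sqrt s%:R)^-1 <= c.
Proof.
pose S k N : R := \sum_(1 <= s < N.+1 | smooth k s) (Num.sqrt s%:R)^-1.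
have S_ge0 k' N (p : pred nat) :
    0 <= \sum_(1 <= s < N.+1 | smooth k' s && p s) (Num.sqrt s%:R)^-1 :> R.
  by rewrite sumr_ge0// => i _; rewrite invr_ge0.
have S1 N k' : (k' <= 1)%N -> S k' N <= 1.
  move=> k1; rewrite /S (eq_bigl (fun s => (s == 1%N) && smooth k' s)); last first.
    move=> s; apply/idP/andP => [sk|[]//]; split => //; apply/eqP/smooth1.
    by apply: sub_in_pnat sk => p _; rewrite !inE => /leq_trans; apply.
  case: N => [|N]; first by rewrite big_geq.
  rewrite big_ltn_cond// eqxx /= big_nat_cond big1 ?addr0; last first.
    by move=> s /andP[/andP[s1 _] /andP[/eqP s1']]; rewrite s1' in s1.
  by case: (smooth _ _); rewrite ?sqrtr1 ?invr1.
elim: k => [|k [c IH]]; first by exists 1 => N; exact: S1.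
have [k0|k0] := posnP k; first by exists 1 => N; apply: S1; rewrite k0.
have r1 : 1 < Num.sqrt k.+1%:R :> R.
  by rewrite -[ltLHS]sqrtr1 ltr_sqrt ?ltr0n// ltr1n.
have r0 : 0 < Num.sqrt k.+1%:R :> R by lra.
exists (c / (1 - (Num.sqrt k.+1%:R)^-1)) => N.
rewrite -/(S k.+1 N) ler_pdivlMr; last by rewrite subr_gt0 invf_lt1.
rewrite mulrBr mulr1 lerBlDr.
have SE : S k.+1 N =
    \sum_(1 <= s < N.+1 | smooth k.+1 s && ~~ (k.+1 %| s)%N) (Num.sqrt s%:R)^-1 +
    \sum_(1 <= s < N.+1 | smooth k.+1 s && (k.+1 %| s)%N) (Num.sqrt s%:R)^-1.
  by rewrite /S (bigID (fun s => k.+1 %| s)%N)/= addrC.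
rewrite {1}SE.
apply: lerD.
  apply: le_trans (IH N); rewrite big_mkcond [leRHS]big_mkcond/=.
  apply: ler_sum => s _; case: ifP => [/andP[sk ks]|_].
    by rewrite smoothS.
  by case: ifP => // _; rewrite invr_ge0.
rewrite (@sum_multiples _ _ _ (smooth k.+1) k.+1)//; last first.
  move=> b _; rewrite andbC; apply: andb_id2l => /dvdnP[s ->].
  rewrite mulnK// smoothM andbC.
  suff -> : smooth k.+1 k.+1 by [].
  by apply/pnatP => // p _ /dvdn_leq; rewrite inE; apply.
rewrite /S mulr_suml.
rewrite [leRHS](@big_cat_nat _ _ _ (N %/ k.+1).+1)//=; last by rewrite ltnS leq_div.
apply: ler_wpDr.
  by rewrite sumr_ge0// => s _; rewrite mulr_ge0 ?invr_ge0.
by apply: ler_sum => s _; rewrite natrM sqrtrM ?ler0n// invfM mulrC.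
Qed.

Definition smooth_count (R : realType) k n : R :=
  \sum_(1 <= s < n.+1 | smooth k s) 1.

(** Rankin's trick: each counted [s <= n] contributes 1, which is at most the ratio of the square
    roots of [n] and [s]. *)
Lemma smooth_count_le_sqrt (R : realType) k : exists c : R, forall n,
  smooth_count R k n <= Num.sqrt n%:R * c.
Proof.
have [c Hc] := sum_smooth_invsqrt_bounded R k; exists c => n.
apply: le_trans (ler_wpM2l (sqrtr_ge0 _) (Hc n)).
rewrite /smooth_count mulr_sumr big_nat_cond [leRHS]big_nat_cond.
apply: ler_sum => s /andP[/andP[s0 sn] _].
rewrite ler_pdivlMr ?sqrtr_gt0 ?ltr0n// mul1r ler_sqrt ?ler0n//.
by rewrite ler_nat -ltnS.
Qed.

(** By the square root bound on the count, the term at a smooth [j] is at most [c / Num.sqrt j], and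
    these have bounded sum. This is the dominating series for both uses of dominated convergence. *)
Lemma cvg_smooth_series (R : realType) k : cvgn (series (fun j : nat =>
  if smooth k j then smooth_count R k j / j%:R else 0)).
Proof.
set u := (X in series X).
have u_ge0 j : 0 <= u j.
  rewrite /u; case: ifP => // _.
  by rewrite divr_ge0// /smooth_count sumr_ge0.
have [c Hc] := smooth_count_le_sqrt R k.
have [e He] := sum_smooth_invsqrt_bounded R k.
have c0 : 0 <= c.
  have := Hc 1%N; rewrite sqrtr1 mul1r; apply: le_trans.
  by rewrite /smooth_count sumr_ge0.
apply: nondecreasing_is_cvgn.
  by apply/nondecreasing_seqP => n; rewrite !seriesEnat/= big_nat_recr//= lerDl.
exists (c * e) => _ [n _ <-]; rewrite /series/=.
apply: (@le_trans _ _ (\sum_(0 <= j < n.+1) u j)).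
  by rewrite big_nat_recr//= lerDl.
rewrite big_ltn//.
have -> : u 0%N = 0 by rewrite /u.
rewrite add0r.
apply: le_trans (ler_wpM2l c0 (He n)).
rewrite mulr_sumr [leRHS]big_mkcond/= big_nat [leRHS]big_nat.
apply: ler_sum => j /andP[j0 _]; rewrite /u; case: ifP => // _.
have sj : 0 < Num.sqrt j%:R :> R by rewrite sqrtr_gt0 ltr0n.
rewrite ler_pdivrMr ?ltr0n//.
have -> : c / Num.sqrt j%:R * j%:R = Num.sqrt j%:R * c.
  by rewrite -[X in _ * X = _]sqr_sqrtr ?ler0n//; field; rewrite gt_eqF.
exact: Hc.
Qed.

End smooth_numbers.

(** * Density of the rough integers *)

Section density.
Implicit Types k n N a : nat.

Definition rough k : pred nat := fun n => (negn (upto k)).-nat n.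

Lemma rough_coprime k a : (0 < a)%N -> rough k a = all (coprime a) (primes_upto k).
Proof.
move=> a0; apply/pnatP/allP => // h r.
  rewrite mem_filter mem_iota => /and3P[pr r1 rk].
  rewrite coprime_sym prime_coprime//; apply/negP => ra.
  by have := h r pr ra; rewrite !inE -ltnS -add1n rk.
move=> pr ra; rewrite !inE; apply/negP => rk.
have := h r; rewrite mem_filter pr mem_iota prime_gt0// add1n ltnS rk => /(_ isT).
by rewrite coprime_sym prime_coprime// ra.
Qed.

(** The primes dividing the factorial are exactly those up to [k]; in this form roughness is visibly
    periodic with period the factorial. *)
Lemma rough_factorial k a : (0 < a)%N -> rough k a = coprime k`! a.
Proof.
move=> a0; apply/idP/idP => [ra|cp].
  have := @pnat_coprime (upto k) k`! a; apply => //.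
  apply/pnatP => [|p pp]; first exact: fact_gt0.
  rewrite inE; elim: k {ra} => [|k IH].
    by rewrite dvdn1 => /eqP p1; rewrite p1 in pp.
  by rewrite factS Euclid_dvdM// => /orP[/dvdn_leq|/IH/leqW//]; apply.
apply/pnatP => // p pp pa; rewrite !inE; apply/negP => pk.
have : (p %| k`!)%N by rewrite dvdn_fact// prime_gt0.
move=> pk'; have := dvdn_gcd p k`! a; rewrite pk' pa (eqP cp) dvdn1.
by move=> /eqP p1; rewrite p1 in pp.
Qed.

Definition rough_count k n : nat := \sum_(1 <= a < n.+1 | rough k a) 1%N.

Lemma rough_count_le k n : (rough_count k n <= n)%N.
Proof.
rewrite /rough_count big_mkcond/= -[leqRHS]card_ord -sum1_card.
rewrite big_add1/= big_mkord; apply: leq_sum => i _; by case: ifP.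
Qed.

Lemma rough_countD k n :
  rough_count k (k`! + n) = (rough_count k k`! + rough_count k n)%N.
Proof.
rewrite /rough_count (@big_cat_nat _ _ _ k`!.+1)//=; last by rewrite ltnS leq_addr.
congr addn; rewrite -{1}add1n -{1}[k`!]addn0 addnCA addn0 -addnS.
rewrite addnC [(k`! + _)%N]addnC big_addn addnK big_nat_cond [RHS]big_nat_cond.
apply: eq_bigl => a; apply: andb_id2l => /andP[a0 _].
rewrite !rough_factorial ?addn_gt0 ?a0//.
by rewrite /coprime gcdnDr.
Qed.

Lemma rough_density (R : realType) k : exists rho : R, forall j, (0 < j)%N ->
  (rough_count k (N %/ j))%:R / N%:R @[N --> \oo] --> rho / j%:R.
Proof.
pose K := k`!; pose phi : R := (rough_count k K)%:R.
have K0 : (0 < K)%N by exact: fact_gt0.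
have K0R : 0 < K%:R :> R by rewrite ltr0n.
pose rho := phi / K%:R; exists rho => j j0.
have rho0 : 0 <= rho by rewrite divr_ge0.
have rho1 : rho <= 1.
  by rewrite ler_pdivrMr// mul1r ler_nat rough_count_le.
have j0R : 0 < j%:R :> R by rewrite ltr0n.
(* Removing a full period leaves the difference unchanged, so only [n < K] matters, where both terms
   lie between 0 and [K]. *)
have count_near n : `|(rough_count k n)%:R - rho * n%:R| <= K%:R.
  elim/ltn_ind: n => n IH; have [nK|Kn] := ltnP n K.
    have : (rough_count k n)%:R <= n%:R :> R by rewrite ler_nat rough_count_le.
    have : rho * n%:R <= n%:R by rewrite ler_piMl.
    have : 0 <= rho * n%:R by rewrite mulr_ge0.
    have : 0 <= (rough_count k n)%:R :> R by [].
    have : n%:R <= K%:R :> R by rewrite ler_nat ltnW.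
    by rewrite ler_norml; lra.
  have := IH (n - K)%N; rewrite ltn_subrL K0 (leq_trans K0 Kn) => /(_ isT).
  rewrite -{3 4}(subnKC Kn) rough_countD !natrD -/K -/phi.
  have -> : phi = rho * K%:R by rewrite /rho divfK ?gt_eqF.
by rewrite mulrDr opprD addrACA subrr add0r.
apply/cvgrPdist_lt => e e0; near=> N.
have N0 : (0 < N)%N by near: N; exact: nbhs_infty_gt.
have N0R : 0 < N%:R :> R by rewrite ltr0n.
have Ke : (K%:R + 1) / e < N%:R by near: N; exact: nbhs_infty_gtr.
rewrite ltr_pdivrMr// in Ke.
have := count_near (N %/ j)%N; set c := rough_count _ _.
have Nj : `|(N %/ j)%:R - N%:R / j%:R| <= 1 :> R.
  rewrite {2}(divn_eq N j) natrD natrM mulrDl mulfK ?gt_eqF//.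
  rewrite opprD addNKr normrN ger0_norm ?divr_ge0//.
  by rewrite ler_pdivrMr// mul1r ler_nat ltnW// ltn_pmod.
move=> cK.
have -> : rho / j%:R - c%:R / N%:R =
    - ((c%:R - rho * (N %/ j)%:R) + rho * ((N %/ j)%:R - N%:R / j%:R)) / N%:R.
  by field; rewrite !gt_eqF.
rewrite mulNr normrN normrM [X in _ * X]ger0_norm ?invr_ge0 ?ltW//.
rewrite ltr_pdivrMr// [ltRHS]mulrC.
apply: le_lt_trans Ke; rewrite (le_trans (ler_normD _ _))// lerD//.
by rewrite normrM ger0_norm// mulr_ile1.
Unshelve. all: by end_near. Qed.

End density.

(** * Independent blocks *)

(** Removes the discretization error: an identity that holds up to [c * e] for every mesh [e] is
    exact. *)
Lemma eq_le_eps (R : realType) (x y c : R) : 0 <= c ->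
  (forall e, 0 < e -> `|x - y| <= c * e) -> x = y.
Proof.
move=> c0 h; apply/eqP; rewrite -subr_eq0 -normr_le0; apply/ler_addgt0Pr => e e0.
rewrite add0r; have c1 : 0 < c + 1 by lra.
apply: le_trans (h (e / (c + 1)) _) _; first by rewrite divr_gt0.
by rewrite mulrA ler_pdivrMr// mulrC ler_pM2l//; lra.
Qed.

Lemma rough_partM k m n : (0 < m)%N -> (0 < n)%N ->
  rough_part k (m * n) = (rough_part k m * rough_part k n)%N.
Proof. exact: partnM. Qed.

Lemma rough_part_smooth k m : smooth k m -> rough_part k m = 1%N.
Proof. by move=> mk; apply: part_p'nat; rewrite pnatNK. Qed.

Lemma smooth_small k m : (0 < m)%N -> (m <= k)%N -> smooth k m.
Proof.
move=> m0 mk; apply/pnatP => // p _ /dvdn_leq => /(_ m0) pm.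
exact: leq_trans mk.
Qed.

Lemma rough_part_gt0 k m : (0 < rough_part k m)%N.
Proof. exact: part_gt0. Qed.

Lemma rough_part_rough k m : rough k (rough_part k m).
Proof. exact: part_pnat. Qed.

Lemma rough_part_le k m : (0 < m)%N -> (rough_part k m <= m)%N.
Proof. by move=> m0; apply: dvdn_leq => //; exact: dvdn_part. Qed.

Lemma sum_blocks (V : nmodType) (G : nat -> V) k N :
  \sum_(1 <= b < N.+1) G b =
  \sum_(1 <= a < N.+1 | rough k a) \sum_(1 <= b < N.+1 | rough_part k b == a) G b.
Proof.
rewrite (exchange_big_dep predT)//= big_nat [RHS]big_nat.
apply: eq_bigr => b /andP[b0 bN]; rewrite big_mkcond/=.
rewrite (bigD1_seq (rough_part k b))/= ?iota_uniq//; last first.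
  by rewrite mem_index_iota rough_part_gt0/= (leq_ltn_trans (rough_part_le k b0)).
rewrite rough_part_rough eqxx big1 ?addr0// => a /negbTE ab.
by rewrite eq_sym ab andbF.
Qed.

(** * Independence on finite product spaces *)

Section finite_product.
Context (R : realType) (I J : finType) (p : I -> R).
Hypothesis p_sum : \sum_i p i = 1.
Implicit Types (Phi Psi : {ffun J -> I} -> R) (y z : {ffun J -> I}).

Definition prod_weight (y : {ffun J -> I}) : R := \prod_j p (y j).

Definition prod_mean (Phi : {ffun J -> I} -> R) : R :=
  \sum_y prod_weight y * Phi y.

Lemma prod_weight_sum : \sum_y prod_weight y = 1.
Proof.
rewrite /prod_weight -(bigA_distr_bigA (fun _ : J => p)) big1// => j _.
Qed.

(* Exchanging the coordinates outside [A] of a pair of points preserves the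
   product weight of the pair. *)
Lemma prod_meanM (A : pred J) Phi Psi :
  (forall y z, {in A, y =1 z} -> Phi y = Phi z) ->
  (forall y z, {in predC A, y =1 z} -> Psi y = Psi z) ->
  prod_mean (fun y => Phi y * Psi y) = prod_mean Phi * prod_mean Psi.
Proof.
move=> PhiA PsiA.
pose mix y z : {ffun J -> I} := [ffun j => if A j then y j else z j].
pose swap (u : {ffun J -> I} * {ffun J -> I}) := (mix u.1 u.2, mix u.2 u.1).
have swapK : involutive swap.
  by move=> [y z]; congr (_, _); apply/ffunP => j; rewrite !ffunE; case: (A j).
rewrite /prod_mean mulr_suml; under [RHS]eq_bigr do rewrite mulr_sumr.
rewrite pair_big_dep/= [RHS](reindex_inj (inv_inj swapK))/=.
transitivity (\sum_(u : {ffun J -> I} * {ffun J -> I})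
    prod_weight u.1 * prod_weight u.2 * (Phi u.1 * Psi u.1)).
  rewrite -[LHS]mulr1 -prod_weight_sum mulr_suml.
  under eq_bigr do rewrite mulr_sumr.
  by rewrite pair_big_dep/=; apply: eq_bigr => u _; ring.
apply: eq_bigr => -[y z] _ /=.
have -> : Phi (mix y z) = Phi y.
  by apply: PhiA => j Aj; rewrite ffunE; move: Aj; rewrite unfold_in => ->.
have -> : Psi (mix z y) = Psi y.
  apply: PsiA => j nAj; rewrite ffunE.
  by have /negbTE -> : ~~ A j by exact: nAj.
have -> : prod_weight y * prod_weight z =
    prod_weight (mix y z) * prod_weight (mix z y).
  rewrite /prod_weight -!big_split/=; apply: eq_bigr => j _.
  by rewrite !ffunE; case: (A j) => //; rewrite mulrC.
by ring.
Qed.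

(** The colors partition the coordinates. Induction on [s]: [prod_meanM] splits off the factor of
    one color, since the other factors only read coordinates of different colors. *)
Lemma prod_mean_prod (C : eqType) (color : J -> C) (s : seq C)
    (Phi : C -> {ffun J -> I} -> R) : uniq s ->
  (forall a y z, (forall j, color j = a -> y j = z j) -> Phi a y = Phi a z) ->
  prod_mean (fun y => \prod_(a <- s) Phi a y) = \prod_(a <- s) prod_mean (Phi a).
Proof.
move=> + PhiE; elim: s => [_|a s IH /= /andP[aNs us]].
  rewrite big_nil -[RHS]prod_weight_sum.
  by apply: eq_bigr => y _; rewrite big_nil mulr1.
rewrite big_cons -IH// -(@prod_meanM (fun j => color j == a)).
- by apply: eq_bigr => y _; rewrite big_cons.
- by move=> y z yz; apply: PhiE => j ja; apply: yz; rewrite unfold_in ja.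
- move=> y z yz; apply: eq_big_seq => b bs; apply: PhiE => j jb.
  apply: yz; rewrite inE; apply/negP => ja.
  have {}ja : color j == a by exact: ja.
  by move: aNs; rewrite -(eqP ja) jb bs.
Qed.

End finite_product.

(** * Reduction of the block identities to finitely many labels *)

Section discretization.
Context (R : realType) (disp : measure_display) (T : measurableType disp).
Context (P : probability T R) (k d : nat).
Context (X : nat -> T -> 'rV[R]_d).
Hypothesis X_meas : forall n : nat, (0 < n)%N -> borel_measurable (X n).
Hypothesis X_indep : mutually_independent P X.
Hypothesis X_id : identically_distributed P X.

Local Notation Ex Y := (\int[P]_w Y w).

Section labels.
Context (I : finType) (lab : 'rV[R]_d -> I).
Hypothesis lab_borel : forall i, borel (lab @^-1` [set i]).

Definition label_weight (i : I) : R := fine (P (X 1%N @^-1` (lab @^-1` [set i]))).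

Lemma measurable_label n i : (0 < n)%N ->
  measurable [set w | lab (X n w) = i].
Proof. by move=> n0; exact: (X_meas n0 (lab_borel i)). Qed.

Lemma label_weight_sum : \sum_i label_weight i = 1.
Proof.
rewrite -(Ex_cst P 1).
transitivity (\sum_i Ex (\1_[set w | lab (X 1%N w) = i])).
  by apply: eq_bigr => i _; rewrite Ex_indic//; exact: measurable_label.
rewrite -Ex_sum => [|i _]; last by apply: bounded_rv_indic; exact: measurable_label.
apply: eq_Rintegral => w _; rewrite (bigD1 (lab (X 1%N w)))//= big1 ?addr0.
  by rewrite indicE mem_set.
move=> i iw; rewrite indicE memNset//= => wi; by rewrite wi eqxx in iw.
Qed.

Context (J : finType) (t : J -> nat).
Hypothesis t_inj : injective t.
Hypothesis t_gt0 : forall j, (0 < t j)%N.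

Definition labels (w : T) : {ffun J -> I} := [ffun j => lab (X (t j) w)].

Let cyl (y : {ffun J -> I}) : set T := [set w | labels w = y].

(** Indexing by natural numbers matches [mutually_independent]: this is a fibre of [lab] when [n] is
    a value of [t], by injectivity, and the whole space otherwise. *)
Let A y n : set 'rV[R]_d := [set x | forall j, t j = n -> lab x = y j].

Let A_borel y n : borel (A y n).
Proof.
have [[j jn]|nj] := pselect (exists j, t j = n).
  rewrite (_ : A y n = lab @^-1` [set y j]); first exact: lab_borel.
  apply/seteqP; split => x; first by apply.
  by move=> xj i ti; rewrite -jn in ti; rewrite (t_inj ti).
rewrite (_ : A y n = setT).
  by apply: sub_sigma_algebra; exact: openT.
by apply/seteqP; split => // x _ j jn; exfalso; apply: nj; exists j.
Qed.

Let cylE y :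
  cyl y = \bigcap_(n in [set` [seq t j | j <- enum J]]) (X n @^-1` A y n).
Proof.
apply/seteqP; split => [w <- n _ j <-|w h]; first by rewrite ffunE.
apply/ffunP => j; rewrite ffunE; apply: (h (t j)) => //=.
by rewrite map_f// mem_enum.
Qed.

Let measurable_cyl y : measurable (cyl y).
Proof.
rewrite cylE; apply: fin_bigcap_measurable => // n /= /mapP[j _ ->].
by apply: X_meas => //; exact: t_gt0.
Qed.

Let P_cyl y : fine (P (cyl y)) = prod_weight label_weight y.
Proof.
rewrite cylE X_indep; last first.
- by move=> n _; exact: A_borel.
- by move=> n /mapP[j _ ->].
- by rewrite map_inj_uniq ?enum_uniq.
rewrite big_map big_enum/=.
have XE j : P (X (t j) @^-1` A y (t j)) = (label_weight (y j))%:E.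
  rewrite (@X_id (t j) 1%N _ (t_gt0 j) isT (@A_borel y (t j))).
  rewrite /label_weight fineK//; last first.
    by apply: fin_num_measure; exact: measurable_label.
  congr (P (_ @^-1` _)); apply/seteqP; split => x; first by apply.
  by move=> xj i /t_inj ->.
by under eq_bigr do rewrite XE; rewrite prodEFin.
Qed.

Let labels_decomp (Phi : {ffun J -> I} -> R) w :
  Phi (labels w) = \sum_y Phi y * \1_(cyl y) w.
Proof.
rewrite (bigD1 (labels w))//= big1 ?addr0.
  by rewrite indicE mem_set// mulr1.
by move=> y yw; rewrite indicE memNset ?mulr0// => wy; rewrite wy eqxx in yw.
Qed.

Lemma bounded_rv_labels (Phi : {ffun J -> I} -> R) :
  bounded_rv (fun w => Phi (labels w)).
Proof.
under eq_fun do rewrite labels_decomp.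
by apply: bounded_rv_sum => y _; exact/bounded_rvZ/bounded_rv_indic.
Qed.

(** Independence and equality of the laws enter here, through [P_cyl]. The right-hand side does not
    mention [t], so the choice of distinct indices is immaterial. *)
Lemma Ex_labels (Phi : {ffun J -> I} -> R) :
  Ex (fun w => Phi (labels w)) = prod_mean label_weight Phi.
Proof.
under eq_Rintegral do rewrite labels_decomp.
rewrite Ex_sum => [|y _]; last exact/bounded_rvZ/bounded_rv_indic.
apply: eq_bigr => y _; rewrite ExZ; last exact: bounded_rv_indic.
by rewrite Ex_indic// P_cyl mulrC.
Qed.

End labels.

(** The same labelling is applied to each row separately, which lets independence of the [X n] pass
    to the labels. *)
Definition discretizable (f : 'M[R]_(k, d) -> R) : Prop := forall e : R, 0 < e ->
  exists (I : finType) (lab : 'rV[R]_d -> I) (W : {ffun 'I_k -> I} -> R),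
    (forall i, borel (lab @^-1` [set i])) /\
    (forall x, `|f x - W [ffun i => lab (row i x)]| <= e).

(** Measurability comes from a pointwise limit of functions of finitely many labels, boundedness
    from a single approximation. *)
Lemma bounded_rv_discretizable f n : discretizable f -> (0 < n)%N ->
  bounded_rv (fun w => f (tup k X n w)).
Proof.
move=> df n0.
have t_gt0 (i : 'I_k) : (0 < i.+1 * n)%N by rewrite muln_gt0.
have t_inj : injective (fun i : 'I_k => i.+1 * n)%N.
  by move=> i j /eqP; rewrite eqn_pmul2r// eqSS => /eqP ij; exact: val_inj.
have step (e : R) : 0 < e -> exists2 Y, bounded_rv Y &
    forall w, `|f (tup k X n w) - Y w| <= e.
  move=> e0; have [I [lab [W [lb fW]]]] := df e e0.
  exists (fun w => W (labels lab (fun i : 'I_k => i.+1 * n)%N w)).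
    exact: bounded_rv_labels.
  move=> w; rewrite (_ : labels _ _ _ = [ffun i => lab (row i (tup k X n w))])//.
  by apply/ffunP => i; rewrite !ffunE rowK.
split; last first.
  have [Y [_ [c Yc]] fY] := step 1 ltr01.
  exists (1 + c) => w; rewrite -[f _](subrK (Y w)).
  by rewrite (le_trans (ler_normD _ _))// lerD.
have /choice[Y YP] : forall m : nat, exists Y : T -> R, bounded_rv Y /\
    forall w, `|f (tup k X n w) - Y w| <= m.+1%:R^-1.
  move=> m; have [|Y bY fY] := step m.+1%:R^-1; first by rewrite invr_gt0.
  by exists Y.
apply: (@measurable_fun_cvg _ _ _ _ Y).
  by move=> m; have [[]] := YP m.
move=> w _; apply/cvgrPdist_lt => e e0; near=> m.
apply: le_lt_trans (proj2 (YP m) w) _.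
rewrite invf_plt ?posrE//; apply: (@lt_trans _ _ m%:R); last by rewrite ltr_nat.
by near: m; exact: nbhs_infty_gtr.
Unshelve. all: by end_near. Qed.

Section sums.
Variables (f : 'M[R]_(k, d) -> R).
Hypothesis df : discretizable f.

Let F (p : pred nat) (a m : nat) (w : T) : R :=
  \sum_(1 <= s < m.+1 | p s) f (tup k X (a * s) w).

Lemma bounded_rv_sum_tup (p : pred nat) (a m : nat) : (0 < a)%N ->
  bounded_rv (fun w => \sum_(1 <= s < m.+1 | p s) f (tup k X (a * s) w)).
Proof.
move=> a0.
under eq_fun do rewrite big_nat_cond.
apply: bounded_rv_sum => s /andP[/andP[s0 _] _].
by apply: bounded_rv_discretizable => //; rewrite muln_gt0 a0.
Qed.

Section discrete.
Context (I : finType) (lab : 'rV[R]_d -> I) (W : {ffun 'I_k -> I} -> R) (e : R).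
Hypothesis lab_borel : forall i, borel (lab @^-1` [set i]).
Hypothesis fW : forall x, `|f x - W [ffun i => lab (row i x)]| <= e.
Variable N : nat.

(* Position [j] of a word carries the label of the variable of index
   [a * j.+1]. *)
Let pos (a : nat) (j : 'I_(k * N).+1) : nat := (a * j.+1)%N.

(** Positions start at 0 and indices at 1, hence the predecessor. For [0 < s <= N] the index is at
    most [k * N], and [inord] loses nothing. *)
Let letters (y : {ffun 'I_(k * N).+1 -> I}) (s : nat) : {ffun 'I_k -> I} :=
  [ffun i : 'I_k => y (inord (i.+1 * s).-1)].

Definition word_sum (p : pred nat) (m : nat) (y : {ffun 'I_(k * N).+1 -> I}) : R :=
  \sum_(1 <= s < m.+1 | p s) W (letters y s).

Let in_range (i : 'I_k) s : (0 < s)%N -> (s <= N)%N ->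
  (inord (i.+1 * s).-1 : 'I_(k * N).+1).+1 = (i.+1 * s)%N.
Proof.
move=> s0 sN; have is0 : (0 < i.+1 * s)%N by rewrite muln_gt0.
by rewrite inordK prednK// leqW// leq_mul.
Qed.

Lemma word_sum_dist (p : pred nat) a m w : (0 < a)%N -> (m <= N)%N -> 0 <= e ->
  `|F p a m w - word_sum p m (labels lab (pos a) w)| <= N%:R * e.
Proof.
move=> a0 mN e0.
rewrite /F /word_sum -sumrB big_mkcond/=.
apply: (@le_trans _ _ (\sum_(1 <= s < m.+1) e)).
  rewrite (le_trans (ler_norm_sum _ _ _))// big_nat [leRHS]big_nat.
  apply: ler_sum => s /andP[s0 sm]; case: ifP => _; last by rewrite normr0.
  rewrite (_ : letters _ s = [ffun i => lab (row i (tup k X (a * s) w))])//.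
  apply/ffunP => i; rewrite !ffunE rowK /pos in_range//.
    by rewrite mulnCA.
  by rewrite (leq_trans _ mN).
rewrite sumr_const_nat subn1/= -[leLHS]mulr_natl.
by rewrite ler_wpM2r// ler_nat.
Qed.

Let pos_gt0 a j : (0 < a)%N -> (0 < pos a j)%N.
Proof. by move=> a0; rewrite muln_gt0 a0. Qed.

Let pos_inj a : (0 < a)%N -> injective (pos a).
Proof.
by move=> a0 i j /eqP; rewrite eqn_pmul2l// eqSS => /eqP ij; exact: val_inj.
Qed.

(** Scale invariance: the right-hand side is free of [a]. *)
Lemma Ex_exp_word_sum (p : pred nat) a m : (0 < a)%N ->
  Ex (fun w => expR (word_sum p m (labels lab (pos a) w))) =
  prod_mean (label_weight lab) (fun y => expR (word_sum p m y)).
Proof.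
move=> a0; apply: (Ex_labels lab_borel (pos_inj a0) _ (fun y => expR (word_sum p m y))).
by move=> j; exact: pos_gt0.
Qed.

Lemma bounded_rv_word_sum (p : pred nat) a m : (0 < a)%N ->
  bounded_rv (fun w => word_sum p m (labels lab (pos a) w)).
Proof.
move=> a0; apply: (bounded_rv_labels lab_borel (pos_inj a0)) => j.
exact: pos_gt0.
Qed.

(* All the variables occurring in the block of [a] have an index with rough
   part [a], so that distinct blocks depend on disjoint sets of coordinates. *)
Lemma prod_mean_blocks :
  prod_mean (label_weight lab) (fun y => expR (word_sum predT N y)) =
  \prod_(1 <= a < N.+1 | rough k a)
    prod_mean (label_weight lab)
      (fun y => expR (word_sum (fun b => rough_part k b == a) N y)).
Proof.
rewrite -[RHS]big_filter -(@prod_mean_prod _ _ _ _ (label_weight_sum lab_borel)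
  _ (fun j : 'I_(k * N).+1 => rough_part k j.+1)); last 2 first.
- by rewrite filter_uniq// iota_uniq.
- move=> a y z yz; congr expR; rewrite /word_sum big_nat_cond [RHS]big_nat_cond.
  apply: eq_bigr => s /andP[/andP[s0 sN] /eqP sa]; congr W.
  apply/ffunP => i; rewrite !ffunE; apply: yz; rewrite in_range//.
  by rewrite rough_partM// rough_part_smooth ?mul1n// smooth_small.
apply: eq_bigr => y _; congr (_ * _).
rewrite -expR_sum; congr expR; rewrite big_filter /word_sum.
exact: sum_blocks.
Qed.

End discrete.

(** Both sides are within [m * e] of the same discrete quantity [L], whence the constant [2 * m]. *)
Lemma ln_E_exp_scale (p : pred nat) a m : (0 < a)%N ->
  ln_E_exp P (fun w => \sum_(1 <= s < m.+1 | p s) f (tup k X (a * s) w)) =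
  ln_E_exp P (fun w => \sum_(1 <= s < m.+1 | p s) f (tup k X (1 * s) w)).
Proof.
move=> a0; apply: (@eq_le_eps _ _ _ (2 * m%:R)) => // e e0.
have [I [lab [W [lb fW]]]] := df e0.
pose L := ln (prod_mean (label_weight lab)
  (fun y : {ffun 'I_(k * m).+1 -> I} => expR (word_sum W p m y))).
have dist a' : (0 < a')%N -> `|ln_E_exp P (F p a' m) - L| <= m%:R * e.
  move=> a'0; rewrite /L -(Ex_exp_word_sum W lb _ p m a'0) -ln_E_expE.
  apply: ln_E_exp_dist => [||w].
  - exact: bounded_rv_sum_tup.
  - exact: bounded_rv_word_sum.
  - by apply: word_sum_dist => //; exact: ltW.
have := dist 1%N isT; have := dist a a0.
rewrite -/(F p a m) -/(F p 1 m) !ler_distl; lra.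
Qed.

Lemma ln_E_exp_blocks N :
  ln_E_exp P (fun w => \sum_(1 <= s < N.+1) f (tup k X (1 * s) w)) =
  \sum_(1 <= a < N.+1 | rough k a)
    ln_E_exp P (fun w => \sum_(1 <= s < N.+1 | rough_part k s == a)
      f (tup k X (1 * s) w)).
Proof.
(* An error [N * e] for the whole sum, and [N * e] for each of at most [N] blocks. *)
apply: (@eq_le_eps _ _ _ (N%:R + N%:R * N%:R)) => // e e0.
have [I [lab [W [lb fW]]]] := df e0.
pose L (p : pred nat) := ln (prod_mean (label_weight lab)
  (fun y : {ffun 'I_(k * N).+1 -> I} => expR (word_sum W p N y))).
pose inb a : pred nat := fun b => rough_part k b == a.
have dist p : `|ln_E_exp P (F p 1 N) - L p| <= N%:R * e.
  rewrite /L -(Ex_exp_word_sum W lb N p N (ltn0Sn 0)) -ln_E_expE.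
  apply: ln_E_exp_dist => [||w].
  - exact: bounded_rv_sum_tup.
  - exact: bounded_rv_word_sum.
  - by apply: word_sum_dist => //; exact: ltW.
have LE : L predT = \sum_(1 <= a < N.+1 | rough k a) L (inb a).
  rewrite /L prod_mean_blocks//.
  rewrite [LHS](_ : _ =
      ln (\prod_(1 <= a < N.+1 | rough k a) expR (L (inb a)))).
    by rewrite -expR_sum expRK.
  congr ln; apply: eq_bigr => a _; rewrite /L lnK// posrE.
  rewrite -(Ex_exp_word_sum W lb N _ N (ltn0Sn 0)).
  exact/Ex_exp_gt0/bounded_rv_word_sum.
rewrite -/(F predT 1 N).
have -> : ln_E_exp P (F predT 1 N) -
    \sum_(1 <= a < N.+1 | rough k a) ln_E_exp P (F (inb a) 1 N) =
  (ln_E_exp P (F predT 1 N) - L predT) +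
    \sum_(1 <= a < N.+1 | rough k a) (L (inb a) - ln_E_exp P (F (inb a) 1 N)).
  by rewrite sumrB LE; ring.
rewrite (le_trans (ler_normD _ _))// mulrDl lerD//.
rewrite (le_trans (ler_norm_sum _ _ _))//.
apply: (@le_trans _ _ (\sum_(1 <= a < N.+1) N%:R * e)).
  rewrite big_mkcond/=; apply: ler_sum => a _; case: ifP => _.
    by rewrite distrC.
  by rewrite mulr_ge0// ltW.
by rewrite sumr_const_nat subn1/= -[leLHS]mulr_natl mulrA.
Qed.

End sums.

End discretization.

(** * Discretization of continuous functions *)

Section compact_power.
Context (R : realType) (k d : nat) (M : set 'rV[R]_d).
Hypothesis M_compact : compact M.
Local Notation Mk := (power_set M : set 'M[R]_(k, d)).

(** Image of a Tychonoff product under the map assembling rows into a matrix, which is continuous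
    because matrix balls are entrywise. *)
Lemma power_set_compact : compact Mk.
Proof.
have cT := @tychonoff 'I_k (fun=> 'rV[R]_d) (fun=> M) (fun=> M_compact).
pose g (x : prod_topology (fun _ : 'I_k => 'rV[R]_d)) : 'M[R]_(k, d) :=
  \matrix_i x i.
rewrite (_ : power_set M = g @` [set f | forall i, M (f i)]); last first.
  apply/seteqP; split => [x xM|x [y yM <-] i]; last by rewrite rowK.
  exists (fun i => row i x) => //.
  by apply/row_matrixP => i; rewrite rowK.
apply: continuous_compact cT; apply: continuous_subspaceT => x.
have FF : Filter (nbhs x) := nbhs_filter x.
apply/cvg_ballP => e e0.
have : \forall y \near x, forall i : 'I_k, ball (x i) e (y i).
  apply: (@filter_forall _ _ (fun i => [set y | ball (x i) e (y i)]) _ FF) => i.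
  have := @proj_continuous 'I_k (fun=> 'rV[R]_d) i x.
  by move=> /cvg_ballP/(_ e e0).
apply: filterS => y xy; split => // i j; rewrite !mxE.
by have [] := xy i.
Qed.

Lemma ball_rows (x y : 'M[R]_(k, d)) (r : R) : 0 < r ->
  (forall i, ball (row i x) r (row i y)) -> ball x r y.
Proof.
by move=> r0 xy; split => // i j; have [_ /(_ ord0 j)] := xy i; rewrite !mxE.
Qed.

Lemma uniformly_continuous_on_power (V : 'M[R]_(k, d) -> R) (e : R) :
  continuous_on_power M V -> 0 < e ->
  exists2 r : R, 0 < r & forall x y, Mk x -> Mk y ->
    (forall i, ball (row i x) r (row i y)) -> `|V x - V y| <= e.
Proof.
move=> /subspace_continuousP cV e0.
have e20 : 0 < e / 2 by lra.
have /compact_near_coveringP nc := power_set_compact.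
(* Membership appears twice: the first is the quantifier over the compact set, the second belongs to
   the covered property, which must also make sense at nearby points that may leave the set. *)
have near_r : \forall r \near (0 : R)^'+, forall x, Mk x -> Mk x -> forall y, Mk y ->
    (forall i, ball (row i x) r (row i y)) -> `|V x - V y| <= e.
  apply: (nc R (0 : R)^'+ (fun r x => Mk x -> forall y, Mk y ->
    (forall i, ball (row i x) r (row i y)) -> `|V x - V y| <= e)) => x Mx.
  have /cvgrPdist_lt/(_ _ e20) := cV x Mx.
  move=> /nbhs_ballP[s /= s0 xs].
  have s20 : 0 < s / 2 by lra.
  near=> x' r => Mx' y My xy.
  have r0 : 0 < r by near: r; exact: nbhs_right_gt.
  have rs : r < s / 2 by near: r; exact: nbhs_right_lt.
  have xx' : ball x (s / 2) x' by near: x'; exact: nbhsx_ballx.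
  have Vx' : `|V x - V x'| < e / 2.
    apply: (xs x') => //; apply: le_ball xx'; lra.
  have Vy : `|V x - V y| < e / 2.
    apply: (xs y) => //; rewrite (splitr s); apply: ball_triangle xx' _.
    by apply: le_ball (ball_rows r0 xy); exact: ltW.
  move: Vx' Vy; rewrite !ltr_distl ler_distl; lra.
near (0 : R)^'+ => r; exists r; first by near: r; exact: nbhs_right_gt.
move=> x y Mx My xy.
have H : forall x, Mk x -> Mk x -> forall y, Mk y ->
  (forall i, ball (row i x) r (row i y)) -> `|V x - V y| <= e by near: r.
exact: H.
Unshelve. all: by end_near. Qed.

Lemma finite_cover_balls (r : R) : 0 < r -> exists s : seq 'rV[R]_d,
  forall x, M x -> exists2 c, c \in s & ball c r x.
Proof.
move=> r0; have := M_compact; rewrite compact_cover.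
move=> /(_ 'rV[R]_d M (fun c => (ball c r)°)) [].
- by move=> c _; exact: open_interior.
- by move=> x Mx; exists x => //; exact: nbhsx_ballx.
move=> D _ MD; exists (finmap.enum_fset D) => x /MD[c cD cx]; exists c => //.
exact: interior_subset cx.
Qed.

Lemma borel_open (U : topologicalType) (A : set U) : open A -> borel A.
Proof. by move=> oA; exact: sub_sigma_algebra. Qed.

(** A label tells whether a point is in [M] and, if so, in which balls of a finite cover of radius
    [r / 2] it lies. Two points of [M] with equal labels share a ball, hence are within [r], and
    uniform continuity applies row by row. *)
Lemma discretizable_on_power (V : 'M[R]_(k, d) -> R) :
  continuous_on_power M V -> discretizable (on_power M V).
Proof.
move=> cV e e0; have [r r0 Vr] := uniformly_continuous_on_power cV e0.
have r20 : 0 < r / 2 by lra.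
have [s Ms] := finite_cover_balls r20.
pose n := size s.
pose B (i : 'I_n) : set 'rV[R]_d := ball (nth 0 s i) (r / 2).
pose lab (x : 'rV[R]_d) : option {ffun 'I_n -> bool} :=
  if x \in M then Some [ffun i => x \in B i] else None.
pose good (y : {ffun 'I_k -> option {ffun 'I_n -> bool}}) (x : 'M[R]_(k, d)) :=
  Mk x /\ y = [ffun i => lab (row i x)].
(* The value at a chosen matrix of [Mk] with these labels. If there is none, 0 agrees with the value
   of [on_power] outside [Mk]. *)
pose W y : R := if pselect (exists x, good y x) is left h then V (projT1 (cid h)) else 0.
exists (option {ffun 'I_n -> bool}), lab, W; split.
  have cM : closed M by apply: compact_closed => //; exact: norm_hausdorff.
  have bM : @measurable _ (g_sigma_algebraType (@open 'rV[R]_d)) M.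
    rewrite -(setCK M); apply: measurableC; apply: borel_open.
    exact: closed_openC.
  have bB i : @measurable _ (g_sigma_algebraType (@open 'rV[R]_d)) (B i).
    by apply: borel_open; exact: ball_open.
  case=> [g|].
    rewrite (_ : lab @^-1` [set Some g] = M `&`
        \bigcap_(i in [set: 'I_n]) (if g i then B i else ~` B i)).
      apply: (@measurableI _ (g_sigma_algebraType (@open 'rV[R]_d))) => //.
      apply: (@fin_bigcap_measurable _ (g_sigma_algebraType (@open 'rV[R]_d))) => // i _.
      by case: (g i) => //; exact: measurableC.
    apply/seteqP; split => x; rewrite /lab/=.
      case: ifPn => // /set_mem Mx [<-]; split => // i _; rewrite ffunE.
      by case: ifPn => [/set_mem//|/negP h Bx]; apply: h; exact: mem_set.
    move=> [/mem_set -> gx]; congr Some; apply/ffunP => i; rewrite ffunE.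
    have := gx i Logic.I; case: (g i) => h; first exact: mem_set.
    by apply: memNset.
  rewrite (_ : lab @^-1` [set None] = ~` M).
    by apply: (@measurableC _ (g_sigma_algebraType (@open 'rV[R]_d))).
  apply/seteqP; split => x; rewrite /lab/=.
    by case: ifPn => // /negP xM _ Mx; apply: xM; exact: mem_set.
  by move=> xM; rewrite memNset.
move=> x; rewrite /W; case: pselect => [h|h].
  case: (cid h) => x' [Mx' lx] /=.
  have lxi i : lab (row i x) = lab (row i x').
    by move/ffunP : lx => /(_ i); rewrite !ffunE.
  have Mx : Mk x.
    move=> i; have := lxi i; rewrite /lab (mem_set (Mx' i)).
    by case: ifPn => // /set_mem.
  rewrite /on_power mem_set//; apply: Vr => // i.
  have [c /(nthP 0)[j jn cj] cx] := Ms _ (Mx i).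
  have := lxi i; rewrite /lab !mem_set//; move=> [/ffunP/(_ (Ordinal jn))].
  rewrite !ffunE mem_set; last by rewrite /B/= cj.
  move=> /esym/set_mem; rewrite /B/= cj => cx'.
  rewrite (splitr r); apply: ball_triangle cx'.
  exact: ball_sym.
rewrite /on_power; case: ifPn => [/set_mem Mx|_]; last by rewrite subrr normr0 ltW.
by exfalso; apply: h; exists x.
Qed.

End compact_power.

(** * The limit functional Q *)

(** Summation by parts: write [g] as a sum of increments and exchange the sums, using that
    [j <= N %/ a] exactly when [a <= N %/ j]. *)
Lemma rough_sum_telescope (R : realType) k (g : nat -> R) N : g 0%N = 0 ->
  \sum_(1 <= a < N.+1 | rough k a) g (N %/ a)%N =
  \sum_(1 <= j < N.+1) (g j - g j.-1) * (rough_count k (N %/ j))%:R.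
Proof.
move=> g0.
have gE n : g n = \sum_(1 <= j < n.+1) (g j - g j.-1).
  by rewrite big_add1/= telescope_sumr ?g0 ?subr0.
have le_div a j : (0 < a)%N -> (0 < j)%N -> (j < (N %/ a).+1)%N = (a < (N %/ j).+1)%N.
  by move=> a0 j0; rewrite !ltnS !leq_divRL// mulnC.
transitivity (\sum_(1 <= a < N.+1 | rough k a)
    \sum_(1 <= j < N.+1 | (j < (N %/ a).+1)%N) (g j - g j.-1)).
  rewrite big_nat_cond [RHS]big_nat_cond; apply: eq_bigr => a /andP[/andP[a0 aN] _].
  rewrite gE [RHS](@big_cat_nat _ _ _ (N %/ a).+1)//=; last by rewrite ltnS leq_div.
  rewrite [X in _ + X]big_nat_cond [X in _ + X]big1 ?addr0.
    rewrite [RHS]big_nat_cond big_nat_cond; apply: eq_bigl => j.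
    by rewrite andbT -andbA andbb.
  by move=> j /andP[/andP[]]; rewrite leqNgt => /negbTE ->.
rewrite (exchange_big_dep predT)//= big_nat [RHS]big_nat.
apply: eq_bigr => j /andP[j0 jN].
rewrite /rough_count natr_sum mulr_sumr.
rewrite [LHS](@big_cat_nat _ _ _ (N %/ j).+1)//=; last by rewrite ltnS leq_div.
rewrite [X in _ + X]big_nat_cond [X in _ + X]big1 ?addr0.
  rewrite big_nat_cond [RHS]big_nat_cond; apply: eq_big => a.
    case: (ltnP 0 a) => //= a0; rewrite le_div//.
    by case: (_ < _)%N => //=; rewrite andbT.
  by move=> _; rewrite mulr1.
move=> a /andP[/andP[aj aN] /andP[_]].
rewrite le_div//; last exact: leq_ltn_trans aj.
by rewrite ltnNge aj.
Qed.

Lemma cvg_rough_average (R : realType) k (rho : R) :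
  (forall j, (0 < j)%N ->
    (rough_count k (N %/ j))%:R / N%:R @[N --> \oo] --> rho / j%:R) ->
  forall (g b : nat -> R), g 0%N = 0 ->
  (forall j, `|g j - g j.-1| / j%:R <= b j) -> cvgn (series b) ->
  N%:R^-1 * \sum_(1 <= a < N.+1 | rough k a) g (N %/ a)%N @[N --> \oo] -->
    limn (series (fun j => (g j - g j.-1) * (rho / j%:R))).
Proof.
move=> cvg_rho g b g0 gb cb.
(* Cutting the terms off beyond [N] turns the finite sum into a series. Domination holds since
   [rough_count k (N %/ j) <= N %/ j], so the weight is at most [1 / j]. *)
pose u (N j : nat) : R := if (0 < j < N.+1)%N
  then (g j - g j.-1) * ((rough_count k (N %/ j))%:R / N%:R) else 0.
have uE N : N%:R^-1 * \sum_(1 <= a < N.+1 | rough k a) g (N %/ a)%N =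
    limn (series (u N)).
  rewrite rough_sum_telescope//.
  suff : series (u N) m @[m --> \oo] --> N%:R^-1 *
      \sum_(1 <= j < N.+1) (g j - g j.-1) * (rough_count k (N %/ j))%:R.
    by move=> /cvg_lim ->.
  apply: cvg_near_cst; near=> m.
  have Nm : (N.+1 <= m)%N by near: m; exact: nbhs_infty_ge.
  rewrite /series/= big_ltn; last exact: leq_trans Nm.
  rewrite {1}/u ltnn add0r (@big_cat_nat _ _ _ N.+1)//=.
  rewrite [X in _ + X]big_nat [X in _ + X]big1 ?addr0.
    rewrite mulr_sumr [LHS]big_nat [RHS]big_nat; apply: eq_bigr => j jN.
    by rewrite /u jN [RHS]mulrCA; congr (_ * _); exact: mulrC.
  by move=> j /andP[Nj _]; rewrite /u ltnS [(j <= N)%N]leqNgt Nj andbF.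
under eq_fun do rewrite uE.
apply: dominated_cvg_series cb _ _.
  apply: nearW => N j; rewrite /u; case: ifP => [/andP[j0 jN]|_]; last first.
    by rewrite normr0 (le_trans _ (gb j))// divr_ge0.
  apply: le_trans (gb j); rewrite normrM ler_wpM2l// ger0_norm ?divr_ge0//.
  have N0 : 0 < N%:R :> R by rewrite ltr0n (leq_trans j0).
  rewrite ler_pdivrMr// mulrC ler_pdivlMr ?ltr0n// -natrM ler_nat.
  by rewrite -leq_divRL// rough_count_le.
move=> j; have [->|j0] := posnP j.
  by rewrite /u/= subrr mul0r; exact: cvg_cst.
have : (g j - g j.-1) * ((rough_count k (N %/ j))%:R / N%:R) @[N --> \oo]
    --> (g j - g j.-1) * (rho / j%:R).
  by apply: cvgM; [exact: cvg_cst|exact: cvg_rho].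
apply: cvg_trans; apply: near_eq_cvg; near=> N.
have jN : (j < N.+1)%N by near: N; exact: nbhs_infty_ge.
by rewrite /u j0 jN.
Unshelve. all: by end_near. Qed.

Lemma derivable_le_dist (R : realType) (f : R -> R) (u v c x y : R) :
  (forall t, t \in `]u, v[ -> derivable f t 1) ->
  (forall t, t \in `]u, v[ -> `|derive1 f t| <= c) ->
  x \in `]u, v[ -> y \in `]u, v[ -> `|f x - f y| <= c * `|x - y|.
Proof.
move=> df fc; wlog xy : x y / x <= y.
  move=> H Ix Iy; case: (leP x y) => [xy|/ltW yx]; first exact: H.
  by rewrite distrC (distrC x); exact: H.
move=> Ix Iy.
have sub z : z \in `[x, y] -> z \in `]u, v[.
  by move: Ix Iy; rewrite !in_itv/=; lra.
have [z zxy||z zxy fz] := @MVT_segment R f (derive1 f) x y xy.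
- by rewrite derive1E; apply: derivableP; apply: df; apply: sub; exact: subset_itv_oo_cc.
- by apply: derivable_within_continuous => z /sub; exact: df.
by rewrite distrC fz normrM (distrC x) ler_wpM2r// fc// sub.
Qed.

Lemma is_derive_big (R : realType) (I : Type) (s : seq I) (p : pred I)
    (F : I -> R -> R) (dF : I -> R) (x : R) :
  (forall i, p i -> is_derive x 1 (F i) (dF i)) ->
  is_derive x 1 (fun t => \sum_(i <- s | p i) F i t) (\sum_(i <- s | p i) dF i).
Proof.
move=> dFi; elim: s => [|i s IH].
  under eq_fun do rewrite big_nil.
  by rewrite big_nil; exact: is_derive_cst.
under eq_fun do rewrite big_cons.
rewrite big_cons; case pi: (p i) => //.
by apply: is_deriveD; exact: dFi.
Qed.

Lemma lipschitz_lower_semicontinuous (R : realType) (U : choiceType)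
    (A : set U) (C : set (U -> R)) (q : (U -> R) -> R) :
  (forall V W e, C V -> C W -> 0 <= e ->
    (forall x, A x -> `|V x - W x| <= e) -> `|q V - q W| <= e) ->
  lower_semicontinuous
    (fun V : subspace (C : set {uniform` A -> R}) => (q V)%:E).
Proof.
move=> q_lip V a; rewrite lte_fin => aV.
exists [set W | a < q W]; last by move=> W /=; rewrite lte_fin.
suff : nbhs_subspace (V : subspace (C : set {uniform` A -> R})) [set W | a < q W].
  by [].
(* Points outside [C] are isolated in the subspace topology. *)
have [CV|nCV] := pselect (C V); last first.
  by rewrite -nbhs_subspace_out// => W ->.
rewrite -nbhs_subspace_in//.
pose e := (q V - a) / 2.
have e0 : 0 < e by rewrite divr_gt0// subr_gt0.
apply/uniform_nbhs; exists [set uv : R * R | ball uv.1 e uv.2].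
split; first exact: (entourage_ball _ (PosNum e0)).
move=> W /= VW CW.
have := q_lip V W e CV CW (ltW e0).
move=> /(_ _)/wrap[x Mx|]; first by apply: ltW; exact: VW.
rewrite ler_distl /e => /andP[_]; lra.
Qed.

Section pressure.
Context (R : realType) (disp : measure_display) (T : measurableType disp).
Context (P : probability T R) (k d : nat).
Context (M : set 'rV[R]_d) (X : nat -> T -> 'rV[R]_d).
Hypothesis X_meas : forall n : nat, (0 < n)%N -> borel_measurable (X n).
Hypothesis X_indep : mutually_independent P X.
Hypothesis X_id : identically_distributed P X.
Hypothesis M_compact : compact M.

Local Notation Mk := (power_set M : set 'M[R]_(k, d)).
Local Notation C := (continuous_on_power M : set ('M[R]_(k, d) -> R)).
Local Notation Q := (Q P M X).
Implicit Types V W : 'M[R]_(k, d) -> R.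

Lemma mem_A_ N a : (0 < a)%N -> (a <= N)%N -> (a \in A_ k N) = rough k a.
Proof.
move=> a0 aN; rewrite rough_coprime//; apply/idP/idP.
  by move=> /set_mem[].
by move=> h; apply/mem_set; split.
Qed.

Lemma mem_B_ N a b : rough k a -> (0 < b)%N -> (b <= N)%N ->
  (b \in B_ k N a) = (rough_part k b == a).
Proof.
move=> ra b0 bN; apply/idP/eqP => [/set_mem[_ [e be]]|ab].
  pose f := (\prod_(r <- primes_upto k) r ^ e r)%N.
  have fk : smooth k f.
    rewrite /f big_seq; elim/big_ind : _ => [//|x y sx sy|r].
      by rewrite smoothM sx.
    rewrite mem_filter mem_iota => /andP[pr rk].
    by rewrite /smooth pnatX pnatE// inE -ltnS -add1n; case/andP: rk => _ ->.
  have f0 : (0 < f)%N by case/andP : fk.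
  rewrite be -/f; have a0 : (0 < a)%N by case/andP : ra.
  by rewrite rough_partM// (rough_part_smooth fk) muln1; exact: part_pnat_id.
(* The exponents are the valuations of [b]; the product over primes up to [k] is then the smooth
   part of [b]. *)
apply/mem_set; split => //; exists (logn^~ b).
rewrite -ab -{1}(partnC (upto k) b0) mulnC; congr muln.
rewrite /primes_upto big_filter (widen_partn _ (leq_maxl b k)).
rewrite (@big_cat_nat _ _ _ k.+1)//=; last by rewrite ltnS leq_maxr.
rewrite [X in (_ * X)%N]big_nat_cond [X in (_ * X)%N]big1 ?muln1; last first.
  by move=> p /andP[/andP[kp _]]; rewrite inE leqNgt kp.
rewrite big_ltn_cond// lognE/= expn0 mul1n.
have -> : iota 1 k = index_iota 1 k.+1 by rewrite /index_iota subn1.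
rewrite big_mkcond [RHS]big_mkcond/= big_nat [RHS]big_nat.
apply: eq_bigr => p /andP[_ pk]; rewrite inE -ltnS pk lognE.
by case: (prime p).
Qed.

(** The function [g] of the overview; the factor 1 keeps the shape of [ln_E_exp_scale]. *)
Definition block_moment V (m : nat) : R :=
  ln_E_exp P (fun w => \sum_(1 <= s < m.+1 | smooth k s)
    on_power M V (tup k X (1 * s) w)).

Let dsc V : C V -> discretizable (on_power M V).
Proof. exact: discretizable_on_power. Qed.

Lemma ln_E_exp_SA V N a : C V -> rough k a -> (a <= N)%N ->
  ln_E_exp P (SA_ M X V N a) = block_moment V (N %/ a).
Proof.
move=> CV ra aN; have a0 : (0 < a)%N by case/andP : ra.
rewrite /block_moment -(ln_E_exp_scale X_meas X_indep X_id (dsc CV) _ _ a0).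
congr (ln_E_exp P _); apply/funext => w; rewrite /SA_.
rewrite -(@sum_multiples _ (fun b => on_power M V (tup k X b w))
    (fun b => rough_part k b == a))//.
  rewrite big_nat_cond [RHS]big_nat_cond; apply: eq_bigl => b.
  by apply: andb_id2l => /andP[b0 bN]; rewrite mem_B_.
move=> b b0; apply/eqP/andP => [<-|[/dvdnP[s sE]]].
  split; first exact: dvdn_part.
  rewrite -{1}(partnC (upto k) b0) /rough_part mulnK ?part_gt0//.
  exact: part_pnat.
rewrite sE mulnK// => sk; have s0 : (0 < s)%N by case/andP : sk.
by rewrite rough_partM// rough_part_smooth// mul1n; exact: part_pnat_id.
Qed.

Lemma log_moment_splitE V N : C V ->
  log_moment_split P M X V N =
  N%:R^-1 * \sum_(1 <= a < N.+1 | rough k a) block_moment V (N %/ a).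
Proof.
move=> CV; congr (_ * _); rewrite big_nat_cond [RHS]big_nat_cond.
apply: eq_big => a.
  by apply: andb_id2l => /andP[a0 aN]; rewrite mem_A_.
by move=> /andP[/andP[a0 aN]]; rewrite mem_A_// => ra; rewrite ln_E_exp_SA.
Qed.

Lemma log_momentE V N : C V -> log_moment P M X V N = log_moment_split P M X V N.
Proof.
move=> CV; congr (_ * _).
have -> : S_ M X V N = fun w => \sum_(1 <= s < N.+1) on_power M V (tup k X (1 * s) w).
  by apply/funext => w; apply: eq_bigr => s _; rewrite mul1n.
rewrite (ln_E_exp_blocks X_meas X_indep X_id (dsc CV)).
rewrite big_nat_cond [RHS]big_nat_cond; apply: eq_big => a.
  by apply: andb_id2l => /andP[a0 aN]; rewrite mem_A_.
move=> /andP[/andP[a0 aN] ra]; congr (ln_E_exp P _); apply/funext => w.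
rewrite /SA_ big_nat_cond [RHS]big_nat_cond; apply: eq_big => b.
  by apply: andb_id2l => /andP[b0 bN]; rewrite mem_B_.
by rewrite mul1n.
Qed.

Let bounded_rv_block V m : C V -> bounded_rv (fun w =>
  \sum_(1 <= s < m.+1 | smooth k s) on_power M V (tup k X (1 * s) w)).
Proof. by move=> CV; apply: (bounded_rv_sum_tup X_meas (dsc CV)). Qed.

Lemma on_power_dist V W (e : R) : 0 <= e -> (forall x, Mk x -> `|V x - W x| <= e) ->
  forall x, `|on_power M V x - on_power M W x| <= e.
Proof.
move=> e0 VW x; rewrite /on_power; case: ifPn => [/set_mem|_]; first exact: VW.
by rewrite subrr normr0.
Qed.

Lemma block_moment_dist V W (e : R) m : C V -> C W -> 0 <= e ->
  (forall x, Mk x -> `|V x - W x| <= e) ->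
  `|block_moment V m - block_moment W m| <= smooth_count R k m * e.
Proof.
move=> CV CW e0 VW; apply: ln_E_exp_dist; [exact: bounded_rv_block..|] => w.
rewrite -sumrB (le_trans (ler_norm_sum _ _ _))// /smooth_count mulr_suml.
by apply: ler_sum => s _; rewrite mul1r; exact: on_power_dist.
Qed.

Let Delta V j : R := block_moment V j - block_moment V j.-1.

Let summable_bound (e : R) (j : nat) : R :=
  (e + e) * (if smooth k j then smooth_count R k j / j%:R else 0).

Let cvg_summable_bound e : cvgn (series (summable_bound e)).
Proof. by apply: is_cvg_seriesZ; exact: cvg_smooth_series. Qed.

(** If [j] is not smooth, passing from [j.-1] to [j] adds no term and the increments vanish.
    Otherwise the block moments at [j] and at [j.-1] each contribute one [e] per smooth integer. *)
Lemma Delta_dist V W (e : R) j : C V -> C W -> 0 <= e ->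
  (forall x, Mk x -> `|V x - W x| <= e) ->
  `|Delta V j - Delta W j| / j%:R <= summable_bound e j.
Proof.
move=> CV CW e0 VW; rewrite /summable_bound.
case: j => [|j]; first by rewrite /Delta/= !subrr normr0 mul0r mulr_ge0 ?addr_ge0.
case: ifP => jk; last first.
  have same U : Delta U j.+1 = 0.
    apply/eqP; rewrite subr_eq0; apply/eqP; congr (ln_E_exp P _).
    by apply/funext => w; rewrite big_mkcond big_nat_recr//= jk addr0 -big_mkcond.
  by rewrite !same subrr normr0 mul0r mulr0.
rewrite mulrA ler_wpM2r//.
have -> : Delta V j.+1 - Delta W j.+1 = (block_moment V j.+1 - block_moment W j.+1)
   - (block_moment V j - block_moment W j) by rewrite /Delta/=; ring.
rewrite (le_trans (ler_normB _ _))// mulrDl lerD//.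
  by rewrite mulrC block_moment_dist.
apply: (le_trans (block_moment_dist j CV CW e0 VW)).
rewrite mulrC ler_wpM2l// /smooth_count big_mkcond [leRHS]big_mkcond/=.
by rewrite [leRHS]big_nat_recr//= lerDl; case: ifP.
Qed.

(** An approximation within 1 takes finitely many values. *)
Lemma on_power_bounded V : C V -> exists2 e : R, 0 <= e &
  forall x, `|on_power M V x| <= e.
Proof.
move=> CV; have [I [lab [W [_ fW]]]] := dsc CV ltr01.
exists (1 + \sum_y `|W y|); first by rewrite addr_ge0// sumr_ge0.
move=> x; set y := [ffun i => lab (row i x)].
rewrite -[on_power M V x](subrK (W y)) (le_trans (ler_normD _ _))// lerD//.
by rewrite (bigD1 y)//= lerDl sumr_ge0.
Qed.

Let C0 : C (fun=> 0).
Proof. by move=> x; exact: cvg_cst. Qed.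

Let block0 m : block_moment (fun=> 0) m = 0.
Proof.
rewrite /block_moment -[RHS](ln_E_exp0 P); congr (ln_E_exp P _).
by apply/funext => w; rewrite big1// => s _; rewrite /on_power if_same.
Qed.

Let block_nil V : block_moment V 0 = 0.
Proof.
rewrite /block_moment -[RHS](ln_E_exp0 P); congr (ln_E_exp P _).
by apply/funext => w; rewrite big_geq.
Qed.

(** One [rho] serves all [V], so that the series for [V] can be differentiated term by term in a
    parameter. *)
Lemma pressure_series : exists rho : R, forall V, C V ->
  log_moment P M X V @ \oo --> limn (series (fun j => Delta V j * (rho / j%:R))).
Proof.
have [rho cvg_rho] := rough_density R k; exists rho => V CV.
have [e e0 Ve] := on_power_bounded CV.
have := cvg_rough_average cvg_rho (block_nil V) (b := summable_bound e).
move=> /(_ _ (@cvg_summable_bound e)) h.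
rewrite (_ : log_moment P M X V = fun N => N%:R^-1 *
    \sum_(1 <= a < N.+1 | rough k a) block_moment V (N %/ a)); last first.
  by apply/funext => N; rewrite log_momentE// log_moment_splitE.
apply: h => j.
have := @Delta_dist V (fun=> 0) e j CV C0 e0.
rewrite {2}/Delta !block0 !subr0; apply => x Mx.
by rewrite subr0; have := Ve x; rewrite /on_power mem_set.
Qed.

Lemma cvg_log_moment V : C V -> log_moment P M X V @ \oo --> Q V.
Proof.
by have [rho h] := pressure_series; move=> CV; apply: cvgP; exact: h.
Qed.

Lemma cvg_log_moment_split V : C V -> log_moment_split P M X V @ \oo --> Q V.
Proof.
move=> CV; have := cvg_log_moment CV.
rewrite (_ : log_moment P M X V = log_moment_split P M X V)//.
by apply/funext => N; exact: log_momentE.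
Qed.

Lemma bounded_rv_S V N : C V -> bounded_rv (S_ M X V N).
Proof.
move=> CV; have := bounded_rv_sum_tup X_meas (dsc CV) predT N (ltn0Sn 0).
rewrite (_ : (fun w => _) = S_ M X V N)//; apply/funext => w.
by apply: eq_bigr => s _; rewrite mul1n.
Qed.

Lemma continuous_on_power_comb V W (a b : R) : C V -> C W ->
  C (fun x => a * V x + b * W x).
Proof.
move=> CV CW x; apply: cvgD; apply: cvgM; try exact: cvg_cst.
  exact: CV.
exact: CW.
Qed.

Lemma pressure_convex : convex_function C Q.
Proof.
move=> t V W /set_mem CV /set_mem CW.
have t0 : 0 <= t%:num by [].
have t1 : t%:num <= 1 by [].
change (Q (fun x => t%:num * V x + (1 - t%:num) * W x) <=
  t%:num * Q V + (1 - t%:num) * Q W).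
have CVW := @continuous_on_power_comb V W t%:num (1 - t%:num) CV CW.
have cQ : t%:num * log_moment P M X V N + (1 - t%:num) * log_moment P M X W N
    @[N --> \oo] --> t%:num * Q V + (1 - t%:num) * Q W.
  by apply: cvgD; apply: cvgM; [exact: cvg_cst|exact: cvg_log_moment|
                                exact: cvg_cst|exact: cvg_log_moment].
apply: (ler_cvg_to (cvg_log_moment CVW) cQ).
apply: nearW => N; rewrite /log_moment.
rewrite [t%:num * _]mulrCA [(1 - _) * _]mulrCA -mulrDr ler_wpM2l ?invr_ge0//.
have := ln_E_exp_convex P (bounded_rv_S N CV) (bounded_rv_S N CW) t0 t1.
congr (ln_E_exp P _ <= _); apply/funext => w.
rewrite /S_ !mulr_sumr -big_split/=; apply: eq_bigr => s _.
by rewrite /on_power; case: ifP => // _; rewrite !mulr0 addr0.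
Qed.

Lemma pressure_dist V W (e : R) : C V -> C W -> 0 <= e ->
  (forall x, Mk x -> `|V x - W x| <= e) -> `|Q V - Q W| <= e.
Proof.
move=> CV CW e0 VW.
apply: (cvgr_to_le (cvg_norm (cvgB (cvg_log_moment CV) (cvg_log_moment CW)))).
apply: nearW => N /=; rewrite /log_moment -mulrBr normrM ger0_norm ?invr_ge0//.
have [->|N0] := posnP N; first by rewrite invr0 mul0r.
rewrite ler_pdivrMl ?ltr0n//; apply: ln_E_exp_dist; [exact: bounded_rv_S..|] => w.
rewrite /S_ -sumrB (le_trans (ler_norm_sum _ _ _))//.
apply: (@le_trans _ _ (\sum_(1 <= n < N.+1) e)).
  by apply: ler_sum => n _; exact: on_power_dist.
by rewrite sumr_const_nat subn1/= -[leLHS]mulr_natl.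
Qed.

Lemma pressure_lsc : lower_semicontinuous
  (fun V : subspace (C : set {uniform` Mk -> R}) => (Q V)%:E).
Proof.
by apply: lipschitz_lower_semicontinuous => V W e; exact: pressure_dist.
Qed.

(** * Differentiability of [Q] in a parameter *)

Section parameter.
Variables (L : set R) (V : R -> 'M[R]_(k, d) -> R) (c : R).
Hypothesis CV : forall l, L l -> C (V l).
Hypothesis dV : forall l x, L l -> Mk x -> derivable (fun t => V t x) l 1.
Hypothesis dV_le : forall l x, L l -> Mk x -> `|derive1 (fun t => V t x) l| <= c.
Variable l : R.
Hypothesis Ll : L l.
Variable r : R.
Hypothesis r0 : 0 < r.
Hypothesis LI : `]l - r, l + r[%classic `<=` L.

Local Notation I := (`]l - r, l + r[).

Let Il : l \in I.
Proof. by rewrite in_itv/= ltrBlDr !ltrDl r0. Qed.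

Let IL t : t \in I -> L t.
Proof. by move=> It; exact: LI. Qed.

(** The absolute value of [c] is nonnegative without exhibiting a point of [Mk], as later bounds
    require. *)
Let V_dist t x : t \in I -> Mk x -> `|V t x - V l x| <= `|c| * `|t - l|.
Proof.
move=> It Mx.
apply: (@derivable_le_dist _ (V ^~ x) (l - r) (l + r) _ t l _ _ It Il) => s Is.
- by apply: dV => //; exact: IL.
- by rewrite (le_trans (dV_le (IL Is) Mx))// ler_norm.
Qed.

Let is_derive_on_power t x : L t ->
  is_derive t 1 (fun t => on_power M (V t) x)
    (if x \in Mk then derive1 (V ^~ x) t else 0).
Proof.
move=> Lt; rewrite /on_power; case: ifPn => [/set_mem Mx|_].
  by rewrite derive1E; exact/derivableP/dV.
exact: is_derive_cst.
Qed.

Lemma block_moment_derivable m : derivable (fun t => block_moment (V t) m) l 1.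
Proof.
have [e e0 Ve] := on_power_bounded (CV Ll).
have dY t w : L t -> is_derive t 1
    (fun t => \sum_(1 <= s < m.+1 | smooth k s) on_power M (V t) (tup k X (1 * s) w))
    (\sum_(1 <= s < m.+1 | smooth k s)
      (if tup k X (1 * s) w \in Mk then derive1 (V ^~ (tup k X (1 * s) w)) t else 0)).
  move=> Lt.
  apply: (@is_derive_big _ _ _ _ (fun s t => on_power M (V t) (tup k X (1 * s) w))).
  by move=> s _; exact: is_derive_on_power.
(* Each summand is at most [e] at [l] and moves by at most [|c| * r] over the interval. *)
apply: (@ln_E_exp_derivable _ _ _ P _ (l - r) (l + r) l
  (smooth_count R k m * (e + `|c| * r)) (smooth_count R k m * `|c|) Il).
- by move=> t It; have [] := bounded_rv_block m (CV (IL It)).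
- move=> t w It; rewrite (le_trans (ler_norm_sum _ _ _))// /smooth_count mulr_suml.
  apply: ler_sum => s _; rewrite mul1r; set x := tup _ _ _ _.
  rewrite -[on_power M (V t) x](subrK (on_power M (V l) x)) addrC.
  rewrite (le_trans (ler_normD _ _))// lerD//.
  apply: on_power_dist => [|y My]; first by rewrite mulr_ge0// ltW.
  rewrite (le_trans (V_dist It My))// ler_wpM2l//.
  by move: It; rewrite in_itv/= ler_norml => /andP[? ?]; lra.
- by move=> t w It; have [] := dY t w (IL It).
- move=> t w It; have [_] := dY t w (IL It); rewrite derive1E => ->.
  rewrite (le_trans (ler_norm_sum _ _ _))// /smooth_count mulr_suml.
  apply: ler_sum => s _; rewrite mul1r; case: ifPn => [/set_mem Mx|_].
    by rewrite (le_trans (dV_le (IL It) Mx))// ler_norm.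
  by rewrite normr0.
Qed.

Lemma pressure_derivable_at : derivable (fun t => Q (V t)) l 1.
Proof.
have [rho Qrho] := pressure_series.
pose a V' j := Delta V' j * (rho / j%:R).
have QE V' : C V' -> Q V' = limn (series (a V')).
  by move=> CV'; apply: cvg_lim => //; exact: Qrho.
have cb e : cvgn (series (fun j => `|rho| * summable_bound e j)).
  by apply: is_cvg_seriesZ.
have ca V' : C V' -> cvgn (series (a V')).
  move=> CV'; have [e e0 Ve] := on_power_bounded CV'.
  apply: (cvg_series_dominated (cb e)) => j.
  rewrite /a mulrA normrM normrM normfV normr_nat -mulrA mulrCA ler_wpM2l//.
  have := @Delta_dist V' (fun=> 0) e j CV' C0 e0.
  rewrite {2}/Delta !block0 !subr0; apply => x Mx.
  by rewrite subr0; have := Ve x; rewrite /on_power mem_set.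
(* Term-by-term difference quotients. [Delta_dist] with distance [|c| * |h|] bounds them, after
   division by [|h|], by a summable sequence independent of [h]. *)
pose u (h : R) j := h^-1 * (a (V (h + l)) j - a (V l) j).
have near_I : \forall h \near (0 : R)^', h + l \in I.
  exists r => //= h /=; rewrite sub0r normrN => hr _.
  by rewrite in_itv/=; move: hr; rewrite ltr_norml; lra.
have uE h : h + l \in I -> h^-1 * (Q (V (h + l)) - Q (V l)) = limn (series (u h)).
  move=> Ih; have CVh := CV (IL Ih); have CVl := CV Ll.
  rewrite (QE _ CVh) (QE _ CVl); apply/esym/cvg_lim => //.
  rewrite (_ : series (u h) =
      fun n => h^-1 * (series (a (V (h + l))) n - series (a (V l)) n)).
    by apply: cvgM; [exact: cvg_cst|apply: cvgB; exact: ca].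
  by apply/funext => n; rewrite /series/= -sumrB mulr_sumr.
apply/cvg_ex; exists (limn (series (fun j =>
  derive1 (fun t => Delta (V t) j) l * (rho / j%:R)))).
have : limn (series (u h)) @[h --> (0 : R)^'] --> limn (series (fun j =>
    derive1 (fun t => Delta (V t) j) l * (rho / j%:R))).
  apply: (dominated_cvg_series (cb `|c|)).
    near=> h => j.
    have Ih : h + l \in I by near: h.
    have h0 : h != 0 by near: h; exact: nbhs_dnbhs_neq.
    have h0' : 0 < `|h| by rewrite normr_gt0.
    have := @Delta_dist (V (h + l)) (V l) (`|c| * `|h|) j (CV (IL Ih)) (CV Ll).
    move=> /(_ (mulr_ge0 (normr_ge0 _) (normr_ge0 _))) H.
    have {}H : `|Delta (V (h + l)) j - Delta (V l) j| / j%:R <=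
        `|h| * summable_bound `|c| j.
      rewrite (le_trans (H _))//.
        by move=> x Mx; rewrite (le_trans (V_dist Ih Mx))// addrK.
      by rewrite /summable_bound mulrA mulrDr ![`|h| * _]mulrC.
    rewrite /u /a -mulrBl mulrA normrM normrM [in X in _ * X]normrM !normfV normr_nat.
    rewrite mulrCA ler_wpM2l// -mulrA ler_pdivrMl//.
  move=> j; rewrite /u /a.
  have dD : derivable (fun t => Delta (V t) j) l 1.
    by apply: derivableB; exact: block_moment_derivable.
  have : (h^-1 *: (Delta (V (h *: 1 + l)) j - Delta (V l) j)) * (rho / j%:R)
    @[h --> (0 : R)^'] --> derive1 (fun t => Delta (V t) j) l * (rho / j%:R).
    apply: cvgM; last exact: cvg_cst.
    by rewrite derive1E; exact: dD.
  apply: cvg_trans; apply: near_eq_cvg; apply: nearW => h.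
  by rewrite /GRing.scale/= mulr1 -mulrBl !mulrA.
apply: cvg_trans; apply: near_eq_cvg; near=> h.
by rewrite -uE /GRing.scale/= ?mulr1//; near: h.
Unshelve. all: by end_near. Qed.

End parameter.

Lemma pressure_derivable (L : set R) (V : R -> 'M[R]_(k, d) -> R) : open L ->
  (forall l, L l -> C (V l)) ->
  (forall l x, L l -> Mk x -> derivable (fun t => V t x) l 1) ->
  (exists c : R, forall l x, L l -> Mk x -> `|derive1 (fun t => V t x) l| <= c) ->
  forall l, L l -> derivable (fun t => Q (V t)) l 1.
Proof.
move=> oL CV dV [c dVc] l Ll.
have /nbhs_ballP[r /= r0 rL] : nbhs l L by exact: open_nbhs_nbhs.
apply: (pressure_derivable_at CV dV dVc Ll r0) => t /=.
rewrite in_itv/= => tlr; apply: rL; rewrite /ball/= ltr_norml; lra.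
Qed.

End pressure.

Theorem theorem2p7 (R : realType) (disp : measure_display)
    (T : measurableType disp) (P : probability T R) (k d : nat)
    (M : set 'rV[R]_d) (X : nat -> T -> 'rV[R]_d)
    (k_ge1 : (1 <= k)%N)
    (X_meas : forall n : nat, (0 < n)%N -> borel_measurable (X n))
    (X_indep : mutually_independent P X)
    (X_id : identically_distributed P X)
    (M_supp : M = law_support P (X 1%N))
    (M_compact : compact M) :
  let Mk : set 'M[R]_(k, d) := power_set M in
  let C : set ('M[R]_(k, d) -> R) := continuous_on_power M in
  let Q : ('M[R]_(k, d) -> R) -> R := Q P M X in
  [/\ forall V, C V ->
        log_moment P M X V @ \oo --> Q V /\
        log_moment_split P M X V @ \oo --> Q V,
      convex_function C Q,
      lower_semicontinuous
        (fun V : subspace (C : set {uniform` Mk -> R}) => (Q V)%:E),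
      forall (L : set R) (V : R -> 'M[R]_(k, d) -> R),
        open L ->
        (forall l, L l -> C (V l)) ->
        (forall l x, L l -> Mk x -> derivable (fun t => V t x) l 1) ->
        (exists c : R, forall l x, L l -> Mk x ->
          `|derive1 (fun t => V t x) l| <= c) ->
        forall l, L l -> derivable (fun t => Q (V t)) l 1
    & forall F, C F ->
        (forall K : set R, closed K ->
          (limn_esup (log_prob P M X F K) <=
             - ereal_inf [set J P M X F u | u in K])%E) /\
        (forall U : set R, open U ->
          (- ereal_inf [set J P M X F u | u in U] <=
             limn_einf (log_prob P M X F U))%E) ].
Proof.
move=> Mk C Q0; have lim := cvg_log_moment X_meas X_indep X_id M_compact.
split.
- move=> V CV; split; first exact: lim.
  exact: cvg_log_moment_split.
- exact: pressure_convex.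
- exact: pressure_lsc.
- exact: pressure_derivable.
move=> F CF; have [c c0 Fc] := on_power_bounded M_compact CF.
have CZ (l : R) : continuous_on_power M (l \*: F).
  by move=> x; apply: cvgM; [exact: cvg_cst|exact: CF].
have SZ (l : R) N : S_ M X (l \*: F) N = fun w => l * S_ M X F N w.
  apply/funext => w; rewrite /S_ mulr_sumr; apply: eq_bigr => n _.
  by rewrite /on_power; case: ifP => // _; rewrite mulr0.
have mS N : measurable_fun setT (S_ M X F N).
  by have [] := bounded_rv_S X_meas M_compact N CF.
have S_le N w : `|S_ M X F N w| <= N%:R * c.
  rewrite (le_trans (ler_norm_sum _ _ _))//.
  apply: (@le_trans _ _ (\sum_(1 <= n < N.+1) c)); first exact: ler_sum.
  by rewrite sumr_const_nat subn1/= -[leLHS]mulr_natl.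
have cvg_q (l : R) : N%:R^-1 * ln_E_exp P (fun w => l * S_ M X F N w)
    @[N --> \oo] --> Q0 (l \*: F).
  have -> : (fun N => N%:R^-1 * ln_E_exp P (fun w => l * S_ M X F N w)) =
      log_moment P M X (l \*: F).
    by apply/funext => N; rewrite /log_moment SZ.
  exact: (lim k _ (CZ l)).
have dZ (x : 'M[R]_(k, d)) (t : R) : is_derive t 1 (fun l => (l \*: F) x) (F x).
  rewrite (_ : (fun l => _) = F x \*: (id : R -> R)); last first.
    by apply/funext => l; exact: mulrC.
  by have := is_deriveZ (F x) (is_derive_id t (1 : R)); rewrite /GRing.scale/= mulr1.
(* The parametric family [t \*: F] has derivative [F x] in [t], bounded by [c] on [Mk]; the
   resulting differentiability feeds the lower large deviation bound. *)
have dq (l : R) : derivable (fun t : R => Q0 (t \*: F)) l 1.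
  apply: (@pressure_derivable _ _ _ _ _ _ _ _ X_meas X_indep X_id M_compact
    setT (fun t : R => t \*: F)) => //.
  - exact: openT.
  - exists c => t x _ Mx; have [_] := dZ x t; rewrite derive1E => ->.
    by have := Fc x; rewrite /on_power mem_set.
split => [K cK|U oU].
- exact: (ge_upper_bound mS S_le cvg_q).
- exact: (ge_lower_bound mS S_le cvg_q dq).
Qed.
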